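(* Let $\mathcal M_{\rm val,stat}^*(T,\epsilon,\eta;1)$ be the least number $M$ of pooled IID demand observations for which one estimator of $V_1^*(1)$ is $\epsilon$-accurate with probability at least $1-\eta$, uniformly over stationary backlog instances with horizon $T$, IID demand on $[0,1]$ and known, time-homogeneous costs $0<h,p\le1$. For $T\ge8$, $0<\epsilon\le T/1024$, and $0<\eta\le1/4$, $$\mathcal M_{\rm val,stat}^*(T,\epsilon,\eta;1)=\Theta\!\left(T^3\epsilon^{-2}\log(1/\eta)\right),$$ with universal implied constants.
   Context: Backlog inventory model. Horizon $T$; $u^+=\max\{u,0\}$. Demands $D_1,\ldots,D_T$ are IID with law $P$ on $[0,1]$. Fixed and per-unit ordering costs, lead time, and terminal salvage value are zero. Starting period $t$ with inventory $x_t$, the retailer chooses a post-order level $y_t\ge\max\{x_t,0\}$ before observing $D_t$ and incurs $h(y_t-D_t)^++p(D_t-y_t)^+$; the next state is $y_t-D_t$. Feasible policies use the information then available and may randomize; $V_1^*(x)$ is the infimum over feasible policies of the expected total cost over $T$ periods from initial inventory $x$. Pooled IID demand observations are fully observed scalars $(D^1,\ldots,D^M)\sim P^{\otimes M}$. An estimator outputs a scalar $\widehat v$, as a possibly randomized function of these data and the known costs (not of $P$); it is $\epsilon$-accurate with probability at least $1-\eta$ if $\mathbb P(|\widehat v-V_1^*(1)|>\epsilon)\le\eta$. Logarithms are natural. *)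

(* Defs.v *)
From HB Require Import structures.
From mathcomp Require Export all_boot all_order all_algebra.
From mathcomp Require Export all_classical all_reals all_analysis.
Export Order.TTheory GRing.Theory Num.Theory.
Export numFieldNormedType.Exports.

Set Implicit Arguments.
Unset Strict Implicit.
Unset Printing Implicit Defensive.

Global Open Scope classical_set_scope.
Global Open Scope ring_scope.

Section iid_sample.
Context {d : measure_display} {T : measurableType d} {R : realType}.

Definition tuple_cons n (zw : T * n.-tuple T) : n.+1.-tuple T :=
  [tuple of zw.1 :: zw.2].

Lemma measurable_tuple_cons n :
  measurable_fun [set: T * n.-tuple T] (@tuple_cons n).
Proof. by apply: measurable_cons; [exact: measurable_fst | exact: measurable_snd]. Qed.

HB.instance Definition _ n := isMeasurableFun.Build _ _ _ _
  (@tuple_cons n) (@measurable_tuple_cons n).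

(* The product law P^{(x) n} of n IID observations with law P. *)
Fixpoint iid_law (P : probability T R) n : probability (n.-tuple T) R :=
  match n with
  | 0 => \d_([tuple] : 0.-tuple T)
  | n.+1 => distribution (P \x iid_law P n)%E (@tuple_cons n)
  end.

End iid_sample.

Section backlog_inventory.
Context {R : realType}.

(* A history of k periods is the k-tuple of the pairs (y_t, D_t) of post-order
   level and demand.  Starting from inventory x, the inventory at the beginning
   of the next period is y - D for the last such pair, and x if k = 0. *)
Definition inventory (x : R) (w : seq (R * R)) : R :=
  last x [seq yd.1 - yd.2 | yd <- w].

Definition total_cost (h p : R) (w : seq (R * R)) : R :=
  \sum_(yd <- w) (h * Num.max (yd.1 - yd.2) 0 + p * Num.max (yd.2 - yd.1) 0).

(* A randomized history-dependent policy: the conditional law of the post-order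
   level chosen after each history. *)
Definition policy := forall k : nat, R.-pker (k.-tuple (R * R)) ~> R.

Definition feasible (x : R) (pi : policy) : Prop :=
  forall k (w : k.-tuple (R * R)),
    pi k w [set y | Num.max (inventory x w) 0 <= y] = 1%E.

(* Expectation of f(history of n periods) when demands are IID with law P and
   post-order levels are drawn by pi; in each period the demand is drawn
   independently of the history and of the chosen level. *)
Fixpoint policy_expectation (P : probability R R) (pi : policy) n :
    (n.-tuple (R * R) -> \bar R) -> \bar R :=
  match n with
  | 0 => fun f => f [tuple]
  | n.+1 => fun f => policy_expectation P pi
      (fun w : n.-tuple (R * R) =>
         \int[pi n w]_y \int[P]_d f [tuple of rcons w (y, d)])%E
  end.

(* V_1^*(x) for horizon T. *)
Definition optimal_value (T : nat) (P : probability R R) (h p x : R) : \bar R :=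
  ereal_inf [set policy_expectation P pi
                   (fun w : T.-tuple (R * R) => (total_cost h p w)%:E)
            | pi in feasible x].

(* A randomized estimator from M observations; it receives the costs h and p,
   and its output given the data is drawn from a probability kernel. *)
Definition estimator (M : nat) := R -> R -> R.-pker (M.-tuple R) ~> R.

Definition error_probability (P : probability R R) (M : nat)
    (k : R.-pker (M.-tuple R) ~> R) (v : \bar R) (eps : R) : \bar R :=
  (\int[iid_law P M]_data k data [set u : R | eps%:E < `|u%:E - v|])%E.

Definition accurate (T : nat) (eps eta x : R) (M : nat) (est : estimator M) :
    Prop :=
  forall (P : probability R R) (h p : R),
    P `[0, 1]%classic = 1%E -> 0 < h <= 1 -> 0 < p <= 1 ->
    (error_probability P (est h p) (optimal_value T P h p x) eps <= eta%:E)%E.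

(* M is the least number of observations for which one estimator of V_1^*(x) is
   eps-accurate with probability at least 1 - eta on all instances. *)
Definition is_sample_complexity (T : nat) (eps eta x : R) (M : nat) : Prop :=
  (exists est : estimator M, accurate T eps eta x est) /\
  (forall M' : nat,
     (exists est : estimator M', accurate T eps eta x est) -> (M <= M')%N).

End backlog_inventory.

(* Main.v *)
From HB Require Import structures.
Require Import Defs.
From mathcomp Require Import measurable_realfun ring lra.

(** Since [y_t >= (x - D_1 - ... - D_{t-1})^+] for every policy and the expected
    one-period cost [G] is convex, the base-stock policy at a minimizer [s] of
    [G] is optimal and [V_1^*(1)] is its expected cost.

    Upper bound: split the data into [K] blocks of [T] demands and, in each
    block, simulate the base-stock policy at a level [S_b], updated between
    blocks by projected subgradient descent on [G].  The cost of a block lies in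
    [[0, T]] and its conditional mean is at least [V_1^*(1)] and at most
    [V_1^*(1) + T (G S_b - G s)].  The regret bound of subgradient descent and an
    exponential supermartingale give accuracy [eps] once
    [K ~ T^2 eps^-2 ln (1/eta)], that is, with [K T] observations.

    Lower bound: for Bernoulli demand with parameter [q ~ 1/T], [h = p = 1], the
    inventory is held at 1 until the first demand, so the derivative of the value
    in [q] is of order [T^2].  Parameters at distance [16 eps / T^2] therefore
    have values more than [2 eps] apart, while one observation has Hellinger
    affinity [1 - O(eps^2 / T^3)]. *)

Set Implicit Arguments.
Unset Strict Implicit.
Unset Printing Implicit Defensive.

(** * Integration and product laws *)

Section integration.
Context d (T : measurableType d) (R : realType).

(** The integral of a nonnegative function is a supremum over the simple functions below it, so the
    comparison holds for arbitrary integrands. The nested integrals of a policy expectation are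
    compared this way. *)
Lemma ge0_le_integralT (mu : {measure set T -> \bar R}) (f g : T -> \bar R) :
  (forall x, 0 <= f x)%E -> (forall x, f x <= g x)%E ->
  (\int[mu]_x f x <= \int[mu]_x g x)%E.
Proof.
move=> f0 fg; rewrite !ge0_integralTE//; last first.
  by move=> x; exact: le_trans (fg x).
apply: ereal_sup_le => _ [h hf <-]; exists h => // x.
exact: le_trans (hf x) (fg x).
Qed.

Definition bounded_measurable (f : T -> R) :=
  measurable_fun setT f /\ exists B, forall x, `|f x| <= B.

Context (mu : probability T R).

Lemma bounded_measurable_integrable f :
  bounded_measurable f -> mu.-integrable setT (EFin \o f).
Proof.
move=> [mf [B fB]]; apply: measurable_bounded_integrable => //.
  by rewrite (le_lt_trans (probability_le1 _ _))// ltry.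
exists B; split; first exact: num_real.
by move=> M BM x _ /=; exact: le_trans (fB x) (ltW BM).
Qed.

Lemma EFin_Rintegral f : bounded_measurable f ->
  (\int[mu]_x (f x)%:E)%E = (\int[mu]_x f x)%:E.
Proof.
move=> /bounded_measurable_integrable fi.
by rewrite fineK//; exact: integrable_fin_num.
Qed.

Lemma Rintegral_probability_cst r : \int[mu]__ r = r.
Proof. by rewrite Rintegral_cst//= probability_setT mulr1. Qed.

Lemma bounded_measurable_cst r : bounded_measurable (fun _ : T => r).
Proof. by split=> //; exists `|r|. Qed.

Lemma bounded_measurableD f g : bounded_measurable f -> bounded_measurable g ->
  bounded_measurable (fun x => f x + g x).
Proof.
move=> [mf [B fB]] [mg [C gC]]; split; first exact: measurable_funD.
by exists (B + C) => x; rewrite (le_trans (ler_normD _ _))// lerD.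
Qed.

Lemma bounded_measurableZ a f : bounded_measurable f ->
  bounded_measurable (fun x => a * f x).
Proof.
move=> [mf [B fB]]; split; first exact: measurable_funM.
by exists (`|a| * B) => x; rewrite normrM ler_wpM2l.
Qed.

Lemma le_Rintegral_bounded f g :
  bounded_measurable f -> bounded_measurable g -> (forall x, f x <= g x) ->
  \int[mu]_x f x <= \int[mu]_x g x.
Proof.
by move=> bf bg fg; apply: le_Rintegral => //; exact: bounded_measurable_integrable.
Qed.

Lemma RintegralD_bounded f g : bounded_measurable f -> bounded_measurable g ->
  \int[mu]_x (f x + g x) = \int[mu]_x f x + \int[mu]_x g x.
Proof.
by move=> bf bg; apply: RintegralD => //; exact: bounded_measurable_integrable.
Qed.

Lemma RintegralZ_bounded a f : bounded_measurable f ->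
  \int[mu]_x (a * f x) = a * \int[mu]_x f x.
Proof.
by move=> bf; apply: RintegralZl => //; exact: bounded_measurable_integrable.
Qed.

Lemma Rintegral_lipschitz f g r :
  bounded_measurable f -> bounded_measurable g ->
  (forall x, `|f x - g x| <= r) -> `|\int[mu]_x f x - \int[mu]_x g x| <= r.
Proof.
move=> bf bg fg.
have le_shift f1 f2 : bounded_measurable f1 -> bounded_measurable f2 ->
    (forall x, f1 x <= r + f2 x) ->
    \int[mu]_x f1 x <= r + \int[mu]_x f2 x.
  move=> b1 b2 f12; rewrite -{1}(Rintegral_probability_cst r).
  rewrite -RintegralD_bounded//; last exact: bounded_measurable_cst.
  apply: le_Rintegral_bounded => //; apply: bounded_measurableD => //.
  exact: bounded_measurable_cst.
rewrite ler_norml; apply/andP; split.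
  rewrite lerNl opprB lerBlDr; apply: le_shift => // x.
  by have := fg x; rewrite ler_norml => /andP[? ?]; lra.
rewrite lerBlDr; apply: le_shift => // x.
by have := fg x; rewrite ler_norml => /andP[? ?]; lra.
Qed.

(** From [1 - u <= expR (- u)] one gets [expR u <= (1 - u)^-1], and [(1 + u + 2 u^2) (1 - u) = 1 +
    u^2 (1 - 2 u)] is at least 1. *)
Lemma expR_le_quadratic (u : R) :
  `|u| <= 2^-1 -> expR u <= 1 + u + 2 * u ^+ 2.
Proof.
move=> /ler_normlP[_ u1]; have u1' : 0 < 1 - u by lra.
have := expR_ge1Dx (- u); rewrite expRN => eu.
have : expR u <= (1 - u)^-1 by rewrite -[leLHS]invrK lef_pV2 ?posrE ?invr_gt0 ?expR_gt0.
move/le_trans; apply; rewrite -[leLHS]mul1r ler_pdivrMr//.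
suff : 0 <= u ^+ 2 * (1 - 2 * u) by lra.
by rewrite mulr_ge0 ?sqr_ge0//; lra.
Qed.

(** Integrate the quadratic bound on the exponential: the linear term is nonpositive in mean, and
    [1 + v <= expR v] absorbs the quadratic one. *)
Lemma mgf_bound (f : T -> R) B l : measurable_fun setT f -> (forall x, `|f x| <= B) ->
  \int[mu]_x f x <= 0 -> 0 <= l -> l * B <= 2^-1 ->
  (\int[mu]_x (expR (l * f x))%:E <= (expR (2 * (l ^+ 2 * B ^+ 2)))%:E)%E.
Proof.
move=> mf fB f0 l0 lB.
have bf : bounded_measurable f by split => //; exists B.
have bg : bounded_measurable (fun x => (1 + 2 * (l * B) ^+ 2) + l * f x).
  apply: bounded_measurableD; first exact: bounded_measurable_cst.
  exact: bounded_measurableZ.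
apply: (@le_trans _ _ (\int[mu]_x ((1 + 2 * (l * B) ^+ 2) + l * f x)%:E)%E).
  apply: ge0_le_integralT => x; rewrite lee_fin ?expR_ge0//.
  have lf : `|l * f x| <= l * B by rewrite normrM ger0_norm// ler_wpM2l.
  apply: le_trans (expR_le_quadratic (le_trans lf lB)) _.
  rewrite addrAC lerD2r lerD2l ler_pM2l// -(real_normK (num_real (l * f x))).
  by rewrite lerXn2r// nnegrE; exact: le_trans (normr_ge0 _) lf.
rewrite EFin_Rintegral// lee_fin RintegralD_bounded//; first last.
- exact: bounded_measurableZ.
- exact: bounded_measurable_cst.
rewrite Rintegral_probability_cst RintegralZ_bounded// -exprMn.
apply: le_trans (expR_ge1Dx _).
by rewrite gerDl mulr_ge0_le0.
Qed.

End integration.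

(** * Tonelli formulas for IID samples *)

Section iid.
Context d (T : measurableType d) (R : realType) (P : probability T R).
Implicit Types (f : seq T -> \bar R).

Lemma measurable_seq_cons n f :
  measurable_fun setT (fun w : n.+1.-tuple T => f w) ->
  measurable_fun setT (fun zw : T * n.-tuple T => f (zw.1 :: zw.2)).
Proof.
move=> mf.
exact: (measurableT_comp mf (@measurable_tuple_cons _ T n)).
Qed.

Lemma measurable_seq_cons_pair n f x :
  measurable_fun setT (fun w : n.+1.-tuple T => f w) ->
  measurable_fun setT (fun w : n.-tuple T => f (x :: w)).
Proof.
move=> /measurable_seq_cons mf.
exact: (measurableT_comp mf (measurable_pair1 x)).
Qed.

Lemma iid_law_cons n f :
  measurable_fun setT (fun w : n.+1.-tuple T => f w) ->
  (forall w, 0 <= f w)%E ->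
  (\int[iid_law P n.+1]_w f w = \int[P]_x \int[iid_law P n]_w f (x :: w))%E.
Proof.
move=> mf f0 /=; rewrite ge0_integral_distribution//.
by rewrite fubini_tonelli1//; [exact: (@measurable_seq_cons n f mf) | move=> x; exact: f0].
Qed.

Lemma measurable_iid_cons n f :
  measurable_fun setT (fun w : n.+1.-tuple T => f w) ->
  (forall w, 0 <= f w)%E ->
  measurable_fun setT (fun x => \int[iid_law P n]_w f (x :: w))%E.
Proof.
move=> mf f0.
exact: (@measurable_fun_fubini_tonelli_F _ _ _ _ _ (iid_law P n)
  _ (measurable_seq_cons mf) (fun=> f0 _)).
Qed.

Lemma measurable_tuple0 d' (U : measurableType d') (g : 0.-tuple T -> U) :
  measurable_fun setT g.
Proof.
move=> _ Y _; rewrite setTI.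
have [Yg|Yg] := pselect (Y (g [tuple])).
  rewrite (_ : _ @^-1` _ = setT)//; apply/seteqP; split=> // t _ /=.
  by rewrite (tuple0 t).
rewrite (_ : _ @^-1` _ = set0)//; apply/seteqP; split=> // t /=.
by rewrite (tuple0 t).
Qed.

Lemma measurable_tuple_cat n m : measurable_fun setT
  (fun uv : n.-tuple T * m.-tuple T => [tuple of uv.1 ++ uv.2]).
Proof.
apply/measurable_fun_tnthP => i.
case: (split_ordP i) => j ->.
  apply: (eq_measurable_fun (fun uv => tnth uv.1 j)).
    by move=> uv _; exact/esym/(tnth_lshift uv.1 uv.2).
  exact: (measurableT_comp (measurable_tnth j) measurable_fst).
apply: (eq_measurable_fun (fun uv => tnth uv.2 j)).
  by move=> uv _; exact/esym/(tnth_rshift uv.1 uv.2).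
exact: (measurableT_comp (measurable_tnth j) measurable_snd).
Qed.

Lemma measurable_seq_cat n m f :
  measurable_fun setT (fun w : (n + m).-tuple T => f w) ->
  measurable_fun setT
    (fun uv : n.-tuple T * m.-tuple T => f (uv.1 ++ uv.2)).
Proof. by move=> mf; exact: (measurableT_comp mf (@measurable_tuple_cat n m)). Qed.

Lemma measurable_iid_cat n m f :
  measurable_fun setT (fun w : (n + m).-tuple T => f w) ->
  (forall w, 0 <= f w)%E ->
  measurable_fun setT
    (fun u : n.-tuple T => \int[iid_law P m]_v f (u ++ v))%E.
Proof.
move=> mf f0.
exact: (@measurable_fun_fubini_tonelli_F _ _ _ _ _ (iid_law P m)
  _ (measurable_seq_cat mf) (fun=> f0 _)).
Qed.

Lemma iid_law_cat n m f :
  measurable_fun setT (fun w : (n + m).-tuple T => f w) ->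
  (forall w, 0 <= f w)%E ->
  (\int[iid_law P (n + m)]_w f w =
   \int[iid_law P n]_u \int[iid_law P m]_v f (u ++ v))%E.
Proof.
elim: n f => [|n IH] f mf f0.
  rewrite [RHS]integral_dirac ?diracT ?mul1e//; exact: measurable_tuple0.
pose F u := (\int[iid_law P m]_v f (u ++ v))%E.
rewrite -[RHS]/(\int[iid_law P n.+1]_u F u)%E iid_law_cons//; last 2 first.
- exact: measurable_iid_cat.
- by move=> w; apply: integral_ge0.
rewrite [LHS](@iid_law_cons (n + m) f)//; apply: eq_integral => x _.
by rewrite (IH (fun w => f (x :: w)))//; exact: (@measurable_seq_cons_pair (n + m)).
Qed.

Lemma bounded_Rintegral_iid_cons n (f : seq T -> R) B :
  measurable_fun setT (fun w : n.+1.-tuple T => f w) ->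
  (forall w, `|f w| <= B) ->
  bounded_measurable (fun x => \int[iid_law P n]_w f (x :: w)).
Proof.
move=> mf fB.
have bc x : bounded_measurable (fun w : n.-tuple T => f (x :: w)).
  split; last by exists B.
  move/measurable_EFinP : mf => /(@measurable_seq_cons_pair n (EFin \o f) x).
  by move/measurable_EFinP.
split.
  (* Adding [B] makes the integrand nonnegative, so that the Tonelli form of the statement
     applies. *)
  pose g w := B + f w.
  have g0 w : 0 <= g w by have := fB w; rewrite ler_norml /g => /andP[? ?]; lra.
  have -> : (fun x => \int[iid_law P n]_w f (x :: w)) =
            (fun x => fine (\int[iid_law P n]_w (g (x :: w))%:E)%E - B).
    apply/funext => x; rewrite [fine _]RintegralD_bounded//; last first.
      exact: bounded_measurable_cst.
    by rewrite Rintegral_probability_cst addrAC subrr add0r.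
  apply: measurable_funB => //; apply: measurableT_comp => //.
  apply: (@measurable_iid_cons n (EFin \o g)) => //.
  by apply/measurable_EFinP; apply: measurable_funD.
exists B => x.
rewrite -[X in `|X|]subr0 -[in X in `|_ - X|](Rintegral_probability_cst (iid_law P n) 0).
apply: Rintegral_lipschitz => //; first exact: bounded_measurable_cst.
by move=> w; rewrite subr0.
Qed.

Lemma Rintegral_iid_cons n (f : seq T -> R) B :
  measurable_fun setT (fun w : n.+1.-tuple T => f w) ->
  (forall w, `|f w| <= B) ->
  \int[iid_law P n.+1]_w f w =
  \int[P]_x \int[iid_law P n]_w f (x :: w).
Proof.
move=> mf fB; pose g w := B + f w.
have g0 w : 0 <= g w by have := fB w; rewrite ler_norml /g => /andP[? ?]; lra.
have b1 : bounded_measurable (fun w : n.+1.-tuple T => f w) by split => //; exists B.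
have bc x : bounded_measurable (fun w : n.-tuple T => f (x :: w)).
  split; last by exists B.
  move/measurable_EFinP : mf => /(@measurable_seq_cons_pair n (EFin \o f) x).
  by move/measurable_EFinP.
have mg : measurable_fun setT (fun w : n.+1.-tuple T => (g w)%:E).
  exact/measurable_EFinP/measurable_funD.
have bI := bounded_Rintegral_iid_cons mf fB.
have shift k (h : seq T -> R) : bounded_measurable (fun w : k.-tuple T => h w) ->
    (\int[iid_law P k]_w (B + h w)%:E)%E = (B + \int[iid_law P k]_w h w)%:E.
  move=> bh; rewrite EFin_Rintegral ?RintegralD_bounded ?Rintegral_probability_cst//.
  - exact: bounded_measurable_cst.
  - by apply: bounded_measurableD => //; exact: bounded_measurable_cst.
have /= := @iid_law_cons n (EFin \o g) mg g0.
rewrite /g /= (shift n.+1 f)//.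
under eq_integral do rewrite (shift n (fun w => f (_ :: w)))//.
rewrite EFin_Rintegral; last first.
  by apply: bounded_measurableD => //; exact: bounded_measurable_cst.
move=> [].
rewrite RintegralD_bounded ?Rintegral_probability_cst//.
  exact: addrI.
exact: bounded_measurable_cst.
Qed.

End iid.

(** * Base-stock costs *)

Section period_cost.
Context (R : realType).
Implicit Types x y d : R.

Lemma lipschitz_continuous_real (f : R -> R) (k : R) :
  (forall x y, `|f x - f y| <= k * `|x - y|) -> continuous f.
Proof.
move=> fk x; apply/cvgrPdist_lt => e e0; near=> y.
(* [k] may be zero or negative; this enlarged constant can be divided by. *)
have k0 : 0 < `|k| + 1 by rewrite ltr_wpDl.
apply: (@le_lt_trans _ _ ((`|k| + 1) * `|x - y|)).
  by apply: le_trans (fk x y) _; rewrite ler_wpM2r// ler_wpDr// ler_norm.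
rewrite mulrC -ltr_pdivlMr//; near: y.
by apply: cvgr_dist_lt => //; rewrite divr_gt0.
Unshelve. all: by end_near. Qed.

Lemma lipschitz_measurable (f : R -> R) (k : R) :
  (forall x y, `|f x - f y| <= k * `|x - y|) -> measurable_fun setT f.
Proof. by move=> /lipschitz_continuous_real; exact: continuous_measurable_fun. Qed.

(** Demand lies in [0, 1] only almost surely. Clipping it makes every cost a bounded function of the
    demand on the whole line. The same map is the projection in subgradient descent. *)
Definition clip d : R := Num.min (Num.max d 0) 1.

Lemma clip_ge0 d : 0 <= clip d.
Proof. by rewrite le_min ler01 le_max lexx orbT. Qed.

Lemma clip_le1 d : clip d <= 1.
Proof. by rewrite ge_min lexx orbT. Qed.

Lemma clip_id d : 0 <= d <= 1 -> clip d = d.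
Proof. by move=> /andP[d0 d1]; rewrite /clip max_l// min_l. Qed.

Lemma measurable_clip : measurable_fun setT clip.
Proof. by apply: measurable_minr => //; exact: measurable_maxr. Qed.

Lemma clip_contraction d x : 0 <= x <= 1 -> (clip d - x) ^+ 2 <= (d - x) ^+ 2.
Proof.
move=> /andP[x0 x1]; rewrite /clip /Num.max /Num.min.
case: (ltP d 0) => d0; case: ifP => d1 //; first by nra.
  by move: d1; rewrite ltr01.
by move/negbT: d1; rewrite -leNgt => d1; nra.
Qed.

Context (h p : R).

Definition period_cost y d : R := h * Num.max (y - d) 0 + p * Num.max (d - y) 0.

Lemma period_cost_le y d : d <= y -> period_cost y d = h * (y - d).
Proof.
move=> dy; rewrite /period_cost max_l ?subr_ge0// max_r ?subr_le0//.
by rewrite mulr0 addr0.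
Qed.

Lemma period_cost_ge y d : y <= d -> period_cost y d = p * (d - y).
Proof.
move=> dy; rewrite /period_cost max_r ?subr_le0// max_l ?subr_ge0//.
by rewrite mulr0 add0r.
Qed.

Context (h01 : 0 < h <= 1) (p01 : 0 < p <= 1).

Let h0 : 0 <= h. Proof. by case/andP: h01 => /ltW. Qed.
Let h1 : h <= 1. Proof. by case/andP: h01. Qed.
Let p0 : 0 <= p. Proof. by case/andP: p01 => /ltW. Qed.
Let p1 : p <= 1. Proof. by case/andP: p01. Qed.

Lemma period_cost_ge0 y d : 0 <= period_cost y d.
Proof. by rewrite addr_ge0// mulr_ge0// le_max lexx orbT. Qed.

Lemma period_cost_dist y d : period_cost y d <= `|y - d|.
Proof.
have [dy|/ltW yd] := leP d y.
  by rewrite period_cost_le// ger0_norm ?subr_ge0// ler_piMl// subr_ge0.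
by rewrite period_cost_ge// distrC ger0_norm ?subr_ge0// ler_piMl// subr_ge0.
Qed.

Lemma period_cost_lipschitz y y' d :
  `|period_cost y d - period_cost y' d| <= `|y - y'|.
Proof.
wlog yy : y y' / y <= y'.
  move=> H; have [|/ltW] := leP y y'; first exact: H.
  by move=> /H; rewrite distrC (distrC y').
rewrite (distrC y) (ger0_norm (_ : 0 <= y' - y)) ?subr_ge0//.
have P1 (q u : R) : 0 <= q -> q <= 1 -> 0 <= u -> 0 <= q * u <= u.
  by move=> q0 q1 u0; rewrite mulr_ge0//= ler_piMl.
have [dy|/ltW yd] := leP d y.
  rewrite !period_cost_le ?(le_trans dy)// ler_norml.
  have /andP[] := P1 h (y' - y) h0 h1 ltac:(lra); lra.
have [dy'|/ltW yd'] := leP d y'.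
  rewrite (period_cost_ge yd) period_cost_le// ler_norml.
  have /andP[] := P1 h (y' - d) h0 h1 ltac:(lra).
  have /andP[] := P1 p (d - y) p0 p1 ltac:(lra); lra.
rewrite !period_cost_ge// ler_norml.
have /andP[] := P1 p (y' - y) p0 p1 ltac:(lra); lra.
Qed.

(* Convexity of the period cost in y, cleared of denominators. *)
Lemma period_cost_convex (s a b d : R) : s <= a <= b ->
  (b - s) * period_cost a d <=
  (b - a) * period_cost s d + (a - s) * period_cost b d.
Proof.
move=> /andP[sa ab].
(* Convexity of [v -> max v z] in the same form; it is applied to the levels [y - d] and, in
   reversed order, to [d - y]. *)
have cvx (z u v w : R) : u <= v <= w ->
    (w - u) * Num.max v z <= (w - v) * Num.max u z + (v - u) * Num.max w z.
  move=> /andP[uv vw]; have [vz|/ltW zv] := leP v z.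
    rewrite (max_r (le_trans uv vz)).
    have : z <= Num.max w z by rewrite le_max lexx orbT.
    by nra.
  rewrite (max_l (le_trans zv vw)).
  have : u <= Num.max u z by rewrite le_max lexx.
  by nra.
have H1 := cvx 0 (s - d) (a - d) (b - d).
have H2 := cvx 0 (d - b) (d - a) (d - s).
have {}H1 := ler_wpM2l h0 (H1 _); have {}H2 := ler_wpM2l p0 (H2 _).
have /H1 {}H1 : s - d <= a - d <= b - d by lra.
have /H2 {}H2 : d - b <= d - a <= d - s by lra.
rewrite /period_cost.
move: H1 H2.
move: (Num.max _ _) (Num.max _ _) (Num.max _ _) (Num.max _ _) (Num.max _ _) (Num.max _ _).
move=> *; lra.
Qed.

Lemma measurable_period_cost y : measurable_fun setT (period_cost y).
Proof.
apply: measurable_funD; apply: measurable_funM => //;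
  apply: measurable_maxr => //; exact: measurable_funB.
Qed.

Lemma measurable_period_cost_clip y :
  measurable_fun setT (fun d => period_cost y (clip d)).
Proof. exact: (measurableT_comp (@measurable_period_cost y) measurable_clip). Qed.

Lemma bounded_period_cost y : bounded_measurable (fun d => period_cost y (clip d)).
Proof.
split; first exact: measurable_period_cost_clip.
exists (`|y| + 1) => d; rewrite ger0_norm ?period_cost_ge0//.
apply: le_trans (period_cost_dist _ _) _; apply: le_trans (ler_normB _ _) _.
by rewrite lerD2l ger0_norm ?clip_ge0 ?clip_le1.
Qed.

Context (P : probability R R).

Definition expected_cost y : R := \int[P]_d period_cost y (clip d).

Lemma expected_cost_ge0 y : 0 <= expected_cost y.
Proof. by apply: Rintegral_ge0 => d _; exact: period_cost_ge0. Qed.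

Lemma expected_cost_lipschitz y y' :
  `|expected_cost y - expected_cost y'| <= `|y - y'|.
Proof.
apply: Rintegral_lipschitz; [exact: bounded_period_cost..|].
by move=> d; exact: period_cost_lipschitz.
Qed.

Definition newsvendor_optimal (S : R) : Prop :=
  0 <= S <= 1 /\ forall y, 0 <= y -> expected_cost S <= expected_cost y.

(** A minimizer over [0, 1] exists by continuity. Above 1 every clipped demand is met and only the
    holding cost grows, so it is also a minimizer over all [y >= 0]. *)
Lemma newsvendor_optimal_exists : exists S, newsvendor_optimal S.
Proof.
have cG : {within `[0, 1], continuous expected_cost}.
  apply: continuous_subspaceT; apply: (@lipschitz_continuous_real _ 1) => x y.
  by rewrite mul1r; exact: expected_cost_lipschitz.
have [S S01 Smin] := EVT_min ler01 cG; exists S; rewrite in_itv/= in S01.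
split=> // y y0; have [y1|y1] := leP y 1; first by apply: Smin; rewrite in_itv/= y0.
apply: le_trans (Smin 1 _) _; first by rewrite in_itv/= ler01 lexx.
apply: le_Rintegral_bounded; [exact: bounded_period_cost..|] => d.
have d1 := clip_le1 d; rewrite !period_cost_le//; last exact: le_trans (ltW y1).
by rewrite ler_wpM2l// lerD2r ltW.
Qed.

Lemma expected_cost_convex (s a b : R) : s <= a <= b ->
  (b - s) * expected_cost a <=
  (b - a) * expected_cost s + (a - s) * expected_cost b.
Proof.
move=> sab; have bc := bounded_period_cost.
rewrite -!RintegralZ_bounded//.
rewrite -RintegralD_bounded; [|exact: bounded_measurableZ..].
apply: le_Rintegral_bounded => [||d].
- exact: bounded_measurableZ.
- by apply: bounded_measurableD; exact: bounded_measurableZ.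
- exact: period_cost_convex.
Qed.

(** The point [a] lies between a minimizer and [b], so convexity bounds its cost by an average of
    the minimum and the cost at [b]. *)
Lemma expected_cost_right S a b : newsvendor_optimal S -> S <= a <= b ->
  expected_cost a <= expected_cost b.
Proof.
move=> [/andP[S0 _] Smin] /andP[Sa ab].
have [->//|/eqP ba] := eqVneq a b.
have sb : S < b by rewrite (le_lt_trans Sa)// lt_neqAle ab andbT; apply/eqP.
rewrite -(ler_pM2l (_ : 0 < b - S)) ?subr_gt0//.
apply: le_trans (expected_cost_convex (_ : S <= a <= b)) _; first by rewrite Sa ab.
have Sb := Smin b (le_trans S0 (ltW sb)).
have : (b - a) * expected_cost S <= (b - a) * expected_cost b.
  by rewrite ler_wpM2l// subr_ge0.
by lra.
Qed.

Lemma expected_cost_left S a b : newsvendor_optimal S -> 0 <= b <= a -> a <= S ->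
  expected_cost a <= expected_cost b.
Proof.
move=> [_ Smin] /andP[b0 ba] aS.
have [->//|ab] := eqVneq a b.
have sb : b < S by rewrite (lt_le_trans _ aS)// lt_neqAle ba andbT eq_sym.
rewrite -(ler_pM2l (_ : 0 < S - b)) ?subr_gt0//.
apply: le_trans (expected_cost_convex (_ : b <= a <= S)) _; first by rewrite ba aS.
have : (a - b) * expected_cost S <= (a - b) * expected_cost b.
  by rewrite ler_wpM2l ?subr_ge0//; exact: Smin.
by lra.
Qed.

(** The state passed on is [x - d] and not [max x S - d]; [base_stock_cost_max] shows that the
    remaining cost is the same. The path of states then does not depend on [S], and two levels can
    be compared period by period. *)
Fixpoint base_stock_cost (S : R) (n : nat) (x : R) : R :=
  match n with
  | 0 => 0
  | n.+1 => expected_cost (Num.max x S)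
            + \int[P]_d base_stock_cost S n (x - clip d)
  end.

Lemma ler_dist_max (a b c : R) : `|Num.max a c - Num.max b c| <= `|a - b|.
Proof.
wlog ab : a b / a <= b.
  move=> H; have [|/ltW] := leP a b; first exact: H.
  by move=> /H; rewrite distrC (distrC b).
rewrite distrC (distrC a) (ger0_norm (_ : 0 <= b - a)) ?subr_ge0//.
rewrite ger0_norm ?subr_ge0 ?le_max2r//; last first.
  by rewrite ge_max !le_max ab lexx orbT.
have [ac|/ltW ca] := leP a c; last by rewrite max_l// (le_trans ca).
have [bc|/ltW cb] := leP b c; lra.
Qed.

Section lipschitz_composition.
Context (F : R -> R) (k : R).
Hypothesis Fk : forall x y, `|F x - F y| <= k * `|x - y|.

Lemma bounded_lipschitz_clip x : bounded_measurable (fun d => F (x - clip d)).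
Proof.
split.
  apply: (measurableT_comp (lipschitz_measurable Fk)).
  by apply: measurable_funB => //; exact: measurable_clip.
exists (`|k| + `|F x|) => d; rewrite -[F _](subrK (F x)).
apply: le_trans (ler_normD _ _) _; rewrite lerD2r.
apply: le_trans (Fk _ _) _; rewrite addrAC subrr add0r normrN.
rewrite (ger0_norm (clip_ge0 d)); apply: le_trans (ler_wpM2r (clip_ge0 d) (ler_norm k)) _.
by rewrite ler_piMr// clip_le1.
Qed.

Lemma Rintegral_lipschitz_clip x y :
  `|\int[P]_d F (x - clip d) - \int[P]_d F (y - clip d)| <= k * `|x - y|.
Proof.
apply: Rintegral_lipschitz; [exact: bounded_lipschitz_clip..|] => d.
apply: le_trans (Fk _ _) _.
by rewrite [X in k * `|X|](_ : _ = x - y)//; ring.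
Qed.

End lipschitz_composition.

(** Each remaining period contributes slope at most 1. The bound supplies measurability and
    boundedness in the demand. *)
Lemma base_stock_cost_lipschitz S n x y :
  `|base_stock_cost S n x - base_stock_cost S n y| <= n%:R * `|x - y|.
Proof.
elim: n x y => [|n IH] x y /=; first by rewrite subrr normr0 mul0r.
rewrite opprD addrACA; apply: le_trans (ler_normD _ _) _.
rewrite -natr1 mulrDl mul1r [leRHS]addrC; apply: lerD.
  apply: le_trans (expected_cost_lipschitz _ _) _; exact: ler_dist_max.
exact: (Rintegral_lipschitz_clip IH).
Qed.

Lemma bounded_base_stock_cost S n x :
  bounded_measurable (fun d => base_stock_cost S n (x - clip d)).
Proof. exact: (bounded_lipschitz_clip (@base_stock_cost_lipschitz S n)). Qed.

Lemma base_stock_cost_ge0 S n x : 0 <= base_stock_cost S n x.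
Proof.
elim: n x => //= n IH x; rewrite addr_ge0 ?expected_cost_ge0//.
by apply: Rintegral_ge0 => d _.
Qed.

(** Clipped demand is nonnegative, so a state that starts at most at [S] stays there and the level
    is [S] in every period. *)
Lemma base_stock_cost_below S n x y : x <= S -> y <= S ->
  base_stock_cost S n x = base_stock_cost S n y.
Proof.
elim: n x y => //= n IH x y xS yS; rewrite !max_r//; congr (_ + _).
apply: eq_Rintegral => d _; have d0 := clip_ge0 d.
by apply: IH; lra.
Qed.

Lemma base_stock_cost_max S n x d :
  base_stock_cost S n (Num.max x S - clip d) = base_stock_cost S n (x - clip d).
Proof.
have [xS|//] := leP x S; have d0 := clip_ge0 d.
by apply: base_stock_cost_below; lra.
Qed.

Lemma base_stock_cost_mono S n x y : newsvendor_optimal S -> x <= y ->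
  base_stock_cost S n x <= base_stock_cost S n y.
Proof.
move=> optS; elim: n x y => //= n IH x y xy; apply: lerD.
  by apply: (expected_cost_right optS); rewrite ge_max !le_max xy lexx !orbT.
apply: le_Rintegral_bounded; [exact: bounded_base_stock_cost..|] => d.
by apply: IH; rewrite lerD2r.
Qed.

(** Along the common path of states, either [S] itself is chosen and minimizes the period cost, or
    the forced level [x] lies above [S], where the expected cost is nondecreasing. *)
Lemma base_stock_cost_min S S' n x : newsvendor_optimal S -> 0 <= S' ->
  base_stock_cost S n x <= base_stock_cost S' n x.
Proof.
move=> optS S0; elim: n x => //= n IH x; apply: lerD; last first.
  by apply: le_Rintegral_bounded => [||d]; [exact: bounded_base_stock_cost..|].
have [xS|/ltW Sx] := leP x S; first by apply: optS.2; rewrite le_max S0 orbT.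
by apply: (expected_cost_right optS); rewrite Sx le_max lexx.
Qed.

(** Along the common path of states, each of the [n] periods loses at most the difference of the
    expected costs at the two levels. *)
Lemma base_stock_cost_regret S S' n x : newsvendor_optimal S -> 0 <= S' ->
  base_stock_cost S' n x <=
  base_stock_cost S n x + n%:R * (expected_cost S' - expected_cost S).
Proof.
move=> optS S0; elim: n x => [|n IH] x /=; first by rewrite mul0r addr0.
have step : expected_cost (Num.max x S') <= expected_cost (Num.max x S)
    + (expected_cost S' - expected_cost S).
  (* The cases are: both levels are reached by ordering; only [S'] is, and [S] is a minimizer; only
     [S] is, and the cost is nonincreasing left of [S]; both levels equal [x]. *)
  have [xS'|/ltW S'x] := leP x S'; have [xS|/ltW Sx] := leP x S.
  - by lra.
  - have := optS.2 x (le_trans (andP optS.1).1 Sx); lra.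
  - have := @expected_cost_left S x S' optS; rewrite S0 S'x => /(_ isT xS); lra.
  - have := optS.2 _ S0; lra.
have bL := bounded_base_stock_cost.
have : \int[P]_d base_stock_cost S' n (x - clip d) <=
    \int[P]_d (base_stock_cost S n (x - clip d)
               + n%:R * (expected_cost S' - expected_cost S)).
  apply: le_Rintegral_bounded => [||d]; [exact: bL| |exact: IH].
  by apply: bounded_measurableD; [exact: bL|exact: bounded_measurable_cst].
rewrite RintegralD_bounded//; last exact: bounded_measurable_cst.
rewrite Rintegral_probability_cst -natr1 mulrDl mul1r.
by move=> H; apply: le_trans (lerD step H) _; rewrite addrACA lerD2l addrC.
Qed.

End period_cost.

(** * The optimal value *)

Section value.
Context (R : realType) (P : probability R R) (h p : R).
Hypotheses (P01 : P `[0, 1]%classic = 1%E).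
Hypotheses (h01 : 0 < h <= 1) (p01 : 0 < p <= 1).

Local Notation G := (expected_cost h p P).
Local Notation L := (base_stock_cost h p P).

(** The law has mass one on [0, 1], where clipping is the identity. This is where the support
    hypothesis enters. *)
Lemma integral_clip (F : R -> \bar R) : measurable_fun setT F ->
  (forall d, 0 <= F d)%E -> (\int[P]_d F d = \int[P]_d F (clip d))%E.
Proof.
move=> mF F0; apply: ge0_ae_eq_integral => //.
  exact: (measurableT_comp mF (@measurable_clip R)).
exists (~` `[0, 1]%classic); split.
- by apply: measurableC; exact: measurable_itv.
- rewrite [LHS]probability_setC ?P01 ?subee//; exact: measurable_itv.
- move=> d /= nF; apply: contra_not nF => /=; rewrite in_itv/= => d01 _.
  by rewrite clip_id.
Qed.

Lemma policy_expectation_le (pi : policy) n (f g : n.-tuple (R * R) -> \bar R) :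
  (forall w, 0 <= f w)%E -> (forall w, f w <= g w)%E ->
  (policy_expectation P pi f <= policy_expectation P pi g)%E.
Proof.
elim: n f g => [|n IH] f g f0 fg /=; first exact: fg.
apply: IH => w.
  by apply: integral_ge0 => y _; exact: integral_ge0.
apply: ge0_le_integralT => y; first exact: integral_ge0.
exact: ge0_le_integralT.
Qed.

Lemma total_cost_rcons (w : seq (R * R)) y d :
  total_cost h p (rcons w (y, d)) = total_cost h p w + period_cost h p y d.
Proof. by rewrite /total_cost big_rcons. Qed.

Lemma inventory_rcons (x : R) (w : seq (R * R)) y d :
  inventory x (rcons w (y, d)) = y - d.
Proof. by rewrite /inventory map_rcons last_rcons. Qed.

Lemma total_cost_ge0 w : 0 <= total_cost h p w.
Proof. by apply: sumr_ge0 => yd _; exact: (period_cost_ge0 h01 p01). Qed.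

Context (S x : R).

(** Hybrid of two policies: the given one for the [n] recorded periods and base stock for the [j]
    remaining ones. Moving one period from [j] to [n] is the inductive step of both bounds on the
    optimal value. *)
Let cost_so_far n (w : n.-tuple (R * R)) j : \bar R :=
  (total_cost h p w + L S j (inventory x w))%:E.

Let cost_so_far_ge0 n (w : n.-tuple (R * R)) j : (0 <= cost_so_far w j)%E.
Proof. by rewrite lee_fin addr_ge0 ?total_cost_ge0 ?base_stock_cost_ge0. Qed.

Let after_order j y := G y + \int[P]_d L S j (y - clip d).

Lemma integral_period_step (c : R) j y : 0 <= c ->
  (\int[P]_d (c + period_cost h p y d + L S j (y - d))%:E)%E =
  (c + after_order j y)%:E.
Proof.
move=> c0; have Llip := base_stock_cost_lipschitz h01 p01 P S j.
have bG := bounded_period_cost h01 p01 y.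
have bL := bounded_base_stock_cost h01 p01 P S j y.
have bc : bounded_measurable (fun _ : R => c) by exact: bounded_measurable_cst.
have bcG := bounded_measurableD bc bG; have bcGL := bounded_measurableD bcG bL.
rewrite (@integral_clip (fun d => (c + period_cost h p y d + L S j (y - d))%:E)).
- rewrite EFin_Rintegral// (RintegralD_bounded P bcG bL) (RintegralD_bounded P bc bG).
  by rewrite Rintegral_probability_cst -addrA.
- apply/measurable_EFinP; apply: measurable_funD.
    by apply: measurable_funD => //; exact: measurable_period_cost.
  apply: (measurableT_comp (lipschitz_measurable Llip)); exact: measurable_funB.
- move=> d; rewrite lee_fin addr_ge0 ?base_stock_cost_ge0//.
  by rewrite addr_ge0 ?(period_cost_ge0 h01 p01).
Qed.

Let integral_step n (w : n.-tuple (R * R)) j y :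
  (\int[P]_d cost_so_far [tuple of rcons w (y, d)] j)%E =
  (total_cost h p w + after_order j y)%:E.
Proof.
rewrite -integral_period_step ?total_cost_ge0//; apply: eq_integral => d _.
by rewrite /cost_so_far /= total_cost_rcons inventory_rcons.
Qed.

Lemma measurable_after_order j : measurable_fun setT (after_order j).
Proof.
have Llip := base_stock_cost_lipschitz h01 p01 P S j.
apply: measurable_funD.
  apply: (@lipschitz_measurable _ _ 1) => y y'.
  by rewrite mul1r; exact: (expected_cost_lipschitz h01 p01).
exact: (lipschitz_measurable (Rintegral_lipschitz_clip P Llip)).
Qed.

(** Replacing one base-stock period by a period of a feasible policy cannot lower the hybrid cost:
    the feasible level [y] has at least the expected cost of the base-stock level, and it leaves at
    least as much inventory, in which the remaining cost is monotone. *)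
Lemma policy_expectation_lower_bound (pi : policy) n j :
  newsvendor_optimal h p P S -> feasible x pi ->
  ((L S (n + j) x)%:E <=
   policy_expectation P pi (fun w : n.-tuple (R * R) => cost_so_far w j))%E.
Proof.
move=> optS feas; elim: n j => [|n IH] j.
  by rewrite /= /cost_so_far /total_cost big_nil add0r.
rewrite addSnnS; apply: le_trans (IH j.+1) _ => /=.
apply: policy_expectation_le => w; first exact: cost_so_far_ge0.
under eq_integral do rewrite integral_step.
set m := inventory x w; pose A : set R := [set y | Num.max m 0 <= y].
have mA : measurable A.
  rewrite (_ : A = `[Num.max m 0, +oo[%classic); first exact: measurable_itv.
  by rewrite set_itvE.
(* The comparison is available only on feasible levels [A], which carry mass one; outside [A] the
   constant is replaced by 0. *)
have <- : (\int[pi n w]_(y in A) (cst (cost_so_far w j.+1)) y = cost_so_far w j.+1)%E.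
  by rewrite integral_cst// (feas n w) mule1.
rewrite integral_mkcond; apply: ge0_le_integralT => y; rewrite patchE; case: ifP => //.
- by move=> _; exact: cost_so_far_ge0.
- rewrite inE => yA; rewrite lee_fin lerD2l; apply: lerD.
    move: yA; rewrite /A /= ge_max => /andP[my y0].
    have [mS|/ltW Sm] := leP m S; first exact: optS.2.
    by apply: (expected_cost_right h01 p01 optS); rewrite Sm.
  apply: le_Rintegral_bounded => [||d]; [exact: bounded_base_stock_cost..|].
  apply: base_stock_cost_mono => //; rewrite lerD2r.
  by move: yA; rewrite /A /= ge_max => /andP[].
- move=> _; rewrite lee_fin addr_ge0 ?total_cost_ge0// addr_ge0 ?expected_cost_ge0//.
  by apply: Rintegral_ge0 => d _; exact: base_stock_cost_ge0.
Qed.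

Lemma measurable_base_stock_level k :
  measurable_fun setT (fun w : k.-tuple (R * R) => Num.max (inventory x w) S).
Proof.
apply: measurable_maxr => //; case: k => [|k]; first exact: measurable_tuple0.
apply: (eq_measurable_fun (fun w : k.+1.-tuple (R * R) =>
    (tnth w ord_max).1 - (tnth w ord_max).2)).
  move=> w _; rewrite /inventory (tnth_nth (0, 0)) /=.
  case: w => w /= /eqP; case/lastP: w => // w [y d].
  rewrite size_rcons => -[<-]; rewrite map_rcons last_rcons.
  by rewrite nth_rcons ltnn eqxx.
by apply: measurable_funB;
  [apply: (measurableT_comp measurable_fst)|apply: (measurableT_comp measurable_snd)];
  exact: measurable_tnth.
Qed.

Definition base_stock_policy : policy :=
  fun k => kdirac (@measurable_base_stock_level k).

Lemma base_stock_policy_feasible : 0 <= S -> feasible x base_stock_policy.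
Proof.
move=> S0 k w; rewrite /= /kdirac diracE mem_set//=.
by rewrite ge_max !le_max lexx S0 !orbT.
Qed.

(** The same exchange is an equality here, because [base_stock_cost_max] identifies the state after
    ordering with the unordered one. *)
Lemma policy_expectation_base_stock n j :
  policy_expectation P base_stock_policy
    (fun w : n.-tuple (R * R) => cost_so_far w j) = (L S (n + j) x)%:E.
Proof.
elim: n j => [|n IH] j; first by rewrite /= /cost_so_far /total_cost big_nil add0r.
rewrite addSnnS -IH /=; congr policy_expectation; apply/funext => w.
under eq_integral do rewrite integral_step.
rewrite integral_dirac//; last first.
  apply/measurable_EFinP; apply: measurable_funD => //.
  exact: measurable_after_order.
rewrite diracT mul1e; congr (_ + (_ + _))%:E.
by apply: eq_Rintegral => d _; exact: base_stock_cost_max.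
Qed.

Lemma optimal_value_base_stock T : newsvendor_optimal h p P S ->
  optimal_value T P h p x = (L S T x)%:E.
Proof.
move=> optS; have fE : (fun w : T.-tuple (R * R) => (total_cost h p w)%:E) =
    (fun w => cost_so_far w 0).
  by apply/funext => w; rewrite /cost_so_far /= addr0.
apply/eqP; rewrite eq_le; apply/andP; split.
  apply: ereal_inf_lbound; exists base_stock_policy.
    by apply: base_stock_policy_feasible; case: optS => /andP[].
  by rewrite fE policy_expectation_base_stock addn0.
apply: le_ereal_inf_tmp => _ [pi feas <-]; rewrite fE -[T in L S T x]addn0.
exact: policy_expectation_lower_bound.
Qed.

End value.

(** * Bernoulli demand and testing *)

Section two_point_demand.
Context (R : realType).

Definition real_of_bool (b : bool) : R := b%:R.

Lemma measurable_real_of_bool : measurable_fun setT real_of_bool.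
Proof. by []. Qed.

HB.instance Definition _ := isMeasurableFun.Build _ _ _ _
  real_of_bool measurable_real_of_bool.

Definition two_point (q : R) : probability R R :=
  distribution (bernoulli_prob q) real_of_bool.

Lemma two_point_integral q (F : R -> \bar R) : 0 <= q <= 1 ->
  measurable_fun setT F -> (forall x, 0 <= F x)%E ->
  (\int[two_point q]_x F x = q%:E * F 1%R + (1 - q)%:E * F 0%R)%E.
Proof.
move=> q01 mF F0; rewrite ge0_integral_distribution//.
by rewrite integral_bernoulli_prob//= => b; exact: F0.
Qed.

Lemma two_point_Rintegral q (F : R -> R) : 0 <= q <= 1 ->
  measurable_fun setT F -> (forall x, 0 <= F x) ->
  \int[two_point q]_x F x = q * F 1 + (1 - q) * F 0.
Proof.
move=> q01 mF F0; rewrite /Rintegral two_point_integral//.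
exact/measurable_EFinP.
Qed.

Lemma two_point_unit_interval q : 0 <= q <= 1 ->
  two_point q `[0, 1]%classic = 1%E.
Proof.
move=> q01; rewrite [LHS]bernoulli_probE//= !diracE !mem_set ?mule1//=.
- by rewrite -EFinD subrKC.
- by rewrite in_itv/= lexx ler01.
- by rewrite in_itv/= lexx ler01.
Qed.

Section two_point_value.
Context (q : R).
Hypothesis q01 : 0 <= q <= 2^-1.

Let q01' : 0 <= q <= 1. Proof. by case/andP: q01 => ? ?; lra. Qed.
Let u01 : 0 < (1 : R) <= 1. Proof. by rewrite ltr01 lexx. Qed.
Let clip0 : clip 0 = 0 :> R. Proof. by rewrite clip_id// lexx ler01. Qed.
Let clip1 : clip 1 = 1 :> R. Proof. by rewrite clip_id// lexx ler01. Qed.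

Let expected_costE y : expected_cost 1 1 (two_point q) y =
  q * period_cost 1 1 y 1 + (1 - q) * period_cost 1 1 y 0.
Proof.
rewrite /expected_cost two_point_Rintegral ?clip0 ?clip1//.
- exact: measurable_period_cost_clip.
- by move=> x; exact: (period_cost_ge0 u01 u01).
Qed.

(** With equal costs the minimizers are the medians of demand, and 0 is a median when [q <= 1/2]. *)
Lemma two_point_newsvendor : newsvendor_optimal 1 1 (two_point q) 0.
Proof.
split; first by rewrite lexx ler01.
move=> y y0; rewrite !expected_costE.
rewrite (@period_cost_le _ _ _ y 0)// (@period_cost_le _ _ _ 0 0)//.
rewrite (@period_cost_ge _ _ _ 0 1)//.
have : 1 - y <= period_cost 1 1 y 1.
  have [y1|/ltW y1] := leP y 1; first by rewrite period_cost_ge// mul1r.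
  by apply: le_trans (period_cost_ge0 u01 u01 _ _); rewrite subr_le0.
by case/andP: q01 => q0 q1 H; nra.
Qed.

Let LE n x : base_stock_cost 1 1 (two_point q) 0 n.+1 x =
  expected_cost 1 1 (two_point q) (Num.max x 0)
  + (q * base_stock_cost 1 1 (two_point q) 0 n (x - 1)
     + (1 - q) * base_stock_cost 1 1 (two_point q) 0 n x).
Proof.
rewrite /= two_point_Rintegral ?clip0 ?clip1 ?subr0//.
- exact: (bounded_base_stock_cost u01 u01 _ _ _ _).1.
- by move=> d; exact: base_stock_cost_ge0.
Qed.

Lemma two_point_cost_depleted n x : x <= 0 ->
  base_stock_cost 1 1 (two_point q) 0 n x = n%:R * q.
Proof.
elim: n x => [|n IH] x x0; first by rewrite mul0r.
rewrite LE max_r// !IH//; last by lra.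
rewrite expected_costE period_cost_ge// (@period_cost_le _ _ _ 0 0)//.
by rewrite -natr1; ring.
Qed.

Definition two_point_cost n := base_stock_cost 1 1 (two_point q) 0 n 1.

(** The unit in stock costs 1 in a period without demand. Once a demand takes it, inventory stays at
    level 0 after ordering and each remaining period costs [q] on average. *)
Lemma two_point_costS n : two_point_cost n.+1 =
  (1 - q) + q * (n%:R * q) + (1 - q) * two_point_cost n.
Proof.
rewrite /two_point_cost LE max_l// subrr two_point_cost_depleted//.
rewrite expected_costE (@period_cost_le _ _ _ 1 1)//.
by rewrite (@period_cost_le _ _ _ 1 0)//; ring.
Qed.

Lemma two_point_optimal_value T :
  optimal_value T (two_point q) 1 1 1 = (two_point_cost T)%:E.
Proof.
apply: (optimal_value_base_stock (two_point_unit_interval q01') u01 u01).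
exact: two_point_newsvendor.
Qed.

(** The unit survives [k] periods with probability [(1 - q)^k >= 1 - k q], and then period [k] costs
    1; sum over [k] from 1 to [n]. *)
Lemma two_point_cost_ge n :
  n%:R - q * (n%:R * (n%:R + 1) / 2) <= two_point_cost n.
Proof.
case/andP: q01 => q0 q1.
elim: n => [|n IH]; first by rewrite !mul0r mulr0 subr0.
rewrite two_point_costS -natr1; set k : R := n%:R.
have k0 : 0 <= k by exact: ler0n.
have : (1 - q) * (k - q * (k * (k + 1) / 2)) <= (1 - q) * two_point_cost n.
  by rewrite ler_wpM2l//; lra.
have : 0 <= q * (k * q) by rewrite !mulr_ge0.
have : 0 <= q ^+ 2 * (k * (k + 1)) by rewrite !mulr_ge0// addr_ge0.
by move=> *; lra.
Qed.

End two_point_value.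

(** Subtracting the two recursions, the new gap is [1 - q0] times the old one plus
    [dq (1 + a1 - n (2 q0 + dq))], with [a1] the cost at [q0 + dq]. As [a1] is almost [n], this
    increment pays for the growth [dq n / 2] of the bound and for the loss of the factor
    [1 - q0]. *)
Lemma two_point_cost_gap (q0 dq : R) (T n : nat) : (0 < T)%N ->
  q0 = (8 * T%:R)^-1 -> 0 <= dq <= q0 -> (n <= T)%N ->
  dq * (n%:R * (n%:R - 1) / 4) <= two_point_cost q0 n - two_point_cost (q0 + dq) n.
Proof.
move=> T0 q0E /andP[dq0 dqq]; have T1 : 1 <= T%:R :> R by rewrite ler1n.
have q0T : q0 * T%:R = 8^-1.
  by rewrite q0E invfM -mulrA mulVf ?mulr1// gt_eqF// (lt_le_trans ltr01).
have q00 : 0 < q0 by rewrite q0E invr_gt0; lra.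
have q08 : q0 <= 8^-1 by rewrite -q0T ler_peMr// ltW.
have h0 : 0 <= q0 <= 2^-1 by apply/andP; split; lra.
have h1 : 0 <= q0 + dq <= 2^-1 by apply/andP; split; lra.
elim: n => [|n IH] nT; first by rewrite !mul0r mulr0 subrr.
have {}IH := IH (ltnW nT).
rewrite !two_point_costS//.
have := two_point_cost_ge h1 n; have := ler0n R n.
have nT' : n%:R + 1 <= T%:R :> R by rewrite natr1 ler_nat.
rewrite -[n.+1%:R]natr1; move: (two_point_cost (q0 + dq) n) (two_point_cost q0 n) IH => a1 a0.
move: n%:R nT' => k kT IH k0 a1k.
have qk : q0 * (k + 1) <= 8^-1 by rewrite -q0T ler_wpM2l// ltW.
have dqk : dq * (k + 1) <= 8^-1.
  by apply: le_trans qk; rewrite ler_wpM2r//; lra.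
(* The parameter [q0 + dq] times [k + 1] is at most 1/4, and half of it is lost in the first-order
   bound. *)
have a1k' : k * (7 / 8) <= a1.
  apply: le_trans a1k; have : k * (q0 * (k + 1) + dq * (k + 1)) <= k * (8^-1 + 8^-1).
    by rewrite ler_wpM2l// lerD.
  by lra.
have H1 : (1 - q0) * (dq * (k * (k - 1) / 4)) <= (1 - q0) * (a0 - a1).
  by rewrite ler_wpM2l//; lra.
have H2 : dq * (k * (7 / 8)) <= dq * a1 by rewrite ler_wpM2l.
have H3 : dq * (k * (q0 + q0 + dq)) <= dq * 1.
  rewrite ler_wpM2l//; lra.
have H4 : dq * k * (q0 * (k + 1)) <= dq * k * 8^-1 by rewrite ler_wpM2l// mulr_ge0.
have H5 : 0 <= dq * k * q0 by rewrite !mulr_ge0// ltW.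
have H6 : 0 <= dq * k by rewrite mulr_ge0.
lra.
Qed.

End two_point_demand.

(** * Hellinger affinity of Bernoulli samples *)

Section affinity.
Context (R : realType).
Implicit Types a b q : R.

Lemma sqrtr_cauchy_schwarz (a1 b1 a2 b2 : R) :
  0 <= a1 -> 0 <= b1 -> 0 <= a2 -> 0 <= b2 ->
  Num.sqrt (a1 * b1) + Num.sqrt (a2 * b2) <= Num.sqrt ((a1 + a2) * (b1 + b2)).
Proof.
move=> a10 b10 a20 b20.
rewrite -[leLHS]ger0_norm ?addr_ge0 ?sqrtr_ge0// -sqrtr_sqr ler_wsqrtr//.
rewrite !sqrtrM//.
have := sqr_sqrtr a10; have := sqr_sqrtr b10.
have := sqr_sqrtr a20; have := sqr_sqrtr b20.
move: (Num.sqrt a1) (Num.sqrt a2) (Num.sqrt b1) (Num.sqrt b2) => x1 x2 y1 y2.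
move=> <- <- <- <-; have := sqr_ge0 (x1 * y2 - x2 * y1); lra.
Qed.

(** Expand the square and bound the cross term by [a (1 - a) + b (1 - b)] through the inequality of
    means. This is the relation between affinity and total variation for two outcomes. *)
Lemma affinity_sqr_le a b : 0 <= a <= 1 -> 0 <= b <= 1 ->
  (Num.sqrt (a * b) + Num.sqrt ((1 - a) * (1 - b))) ^+ 2 <= 1 - (a - b) ^+ 2.
Proof.
move=> /andP[a0 a1] /andP[b0 b1].
have a1' : 0 <= 1 - a by lra.
have b1' : 0 <= 1 - b by lra.
rewrite !sqrtrM//.
have := sqr_sqrtr a0; have := sqr_sqrtr b0.
have := sqr_sqrtr a1'; have := sqr_sqrtr b1'.
move: (Num.sqrt a) (Num.sqrt _) (Num.sqrt b) (Num.sqrt _) => u u' v v' e1 e2 e3 e4.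
have := sqr_ge0 (u * u' - v * v').
have -> : (u * v + u' * v') ^+ 2 = u ^+ 2 * v ^+ 2 + u' ^+ 2 * v' ^+ 2
   + 2 * (u * u') * (v * v') by ring.
have -> : (u * u' - v * v') ^+ 2 = u ^+ 2 * u' ^+ 2 + v ^+ 2 * v' ^+ 2
   - 2 * (u * u') * (v * v') by ring.
by rewrite e1 e2 e3 e4 => H; lra.
Qed.

(** With [x + y] in place of [k] the left side is the harmonic mean, which is at most the geometric
    mean; a smaller [k] weakens the bound. *)
Lemma sqrtr_mul_ge (x y k : R) : 0 < x -> 0 < y -> 0 < k <= x + y ->
  (x + y) / 2 - (x - y) ^+ 2 / (2 * k) <= Num.sqrt (x * y).
Proof.
move=> x0 y0 /andP[k0 kxy]; have xy0 : 0 < x + y by rewrite addr_gt0.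
apply: (@le_trans _ _ ((x + y) / 2 - (x - y) ^+ 2 / (2 * (x + y)))).
  rewrite lerD2l lerN2 ler_wpM2l ?sqr_ge0// lef_pV2 ?posrE ?mulr_gt0//.
  by rewrite ler_pM2l.
have -> : (x + y) / 2 - (x - y) ^+ 2 / (2 * (x + y)) = 2 * (x * y) / (x + y).
  by field; rewrite gt_eqF.
have xy := mulr_gt0 x0 y0.
rewrite ler_pdivrMr// -{1}(sqr_sqrtr (ltW xy)) expr2 mulrA.
rewrite mulrAC [_ * (x + y)]mulrC ler_pM2r ?sqrtr_gt0//.
rewrite sqrtrM ?(ltW x0)//.
have := sqr_sqrtr (ltW x0); have := sqr_sqrtr (ltW y0).
have := sqr_ge0 (Num.sqrt x - Num.sqrt y).
move: (Num.sqrt x) (Num.sqrt y) => u v H <- <-; lra.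
Qed.

Definition two_point_affinity q0 q1 : R :=
  Num.sqrt (q0 * q1) + Num.sqrt ((1 - q0) * (1 - q1)).

(* Tensorization of the Hellinger affinity, proved directly for tests [f]. *)
Lemma affinity_test q0 q1 (M : nat) (f : seq R -> R) :
  0 <= q0 <= 1 -> 0 <= q1 <= 1 ->
  measurable_fun setT (fun w : M.-tuple R => f w) ->
  (forall w, 0 <= f w <= 1) ->
  two_point_affinity q0 q1 ^+ M <=
  two_point_affinity (\int[iid_law (two_point q0) M]_w f w)
                     (\int[iid_law (two_point q1) M]_w f w).
Proof.
move=> hq0 hq1; elim: M f => [|M IH] f mf f01.
  have fE (P : probability R R) : \int[iid_law P 0]_w f w = f [::].
    rewrite /Rintegral /= integral_dirac ?diracT ?mul1e//.
    exact: measurable_tuple0.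
  rewrite expr0 !fE /two_point_affinity -!expr2 !sqrtr_sqr.
  have /andP[f0 f1] := f01 [::].
  by rewrite !ger0_norm ?subr_ge0// subrKC.
have fB w : `|f w| <= 1 by have /andP[f0 f1] := f01 w; rewrite ger0_norm.
have mc x : measurable_fun setT (fun w : M.-tuple R => f (x :: w)).
  move/measurable_EFinP : mf => /(@measurable_seq_cons_pair _ _ _ M (EFin \o f) x).
  by move/measurable_EFinP.
pose F q x := \int[iid_law (two_point q) M]_w f (x :: w).
have F01 q x : 0 <= F q x <= 1.
  have bf : bounded_measurable (fun w : M.-tuple R => f (x :: w)).
    by split => //; exists 1.
  apply/andP; split; first by apply: Rintegral_ge0 => w _; case/andP: (f01 (x :: w)).
  rewrite -[leRHS](Rintegral_probability_cst (iid_law (two_point q) M)).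
  apply: le_Rintegral_bounded => //; first exact: bounded_measurable_cst.
  by move=> w; case/andP: (f01 (x :: w)).
have IE q : 0 <= q <= 1 ->
    \int[iid_law (two_point q) M.+1]_w f w = q * F q 1 + (1 - q) * F q 0.
  move=> hq; rewrite (Rintegral_iid_cons _ mf fB) two_point_Rintegral//.
    exact: (bounded_Rintegral_iid_cons _ mf fB).1.
  by move=> x; case/andP: (F01 q x).
have IH1 x := IH (fun w => f (x :: w)) (mc x) (fun w => f01 (x :: w)).
rewrite !IE// exprS {1}/two_point_affinity mulrDl.
have /andP[q00 q01] := hq0; have /andP[q10 q11] := hq1.
have q01' : 0 <= 1 - q0 by rewrite subr_ge0.
have q11' : 0 <= 1 - q1 by rewrite subr_ge0.
(* The induction hypothesis conditional on the first observation [x], weighted by the square root of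
   its two likelihoods. Cauchy-Schwarz then merges the two acceptance terms and the two rejection
   terms. *)
have step (c x : R) : 0 <= c -> Num.sqrt c * two_point_affinity q0 q1 ^+ M <=
    Num.sqrt (c * (F q0 x * F q1 x))
    + Num.sqrt (c * ((1 - F q0 x) * (1 - F q1 x))).
  by move=> c0; rewrite (sqrtrM _ c0) [X in _ + X](sqrtrM _ c0) -mulrDr ler_wpM2l ?sqrtr_ge0//; exact: IH1.
apply: le_trans (lerD (step _ 1 (mulr_ge0 q00 q10)) (step _ 0 (mulr_ge0 q01' q11'))) _.
have := F01 q0 1; have := F01 q0 0; have := F01 q1 1; have := F01 q1 0.
move: (F q0 1) (F q0 0) (F q1 1) (F q1 0) => x1 x0 y1 y0.
move=> /andP[y00 y01] /andP[y10 y11] /andP[x00 x01] /andP[x10 x11].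
rewrite addrACA /two_point_affinity; apply: lerD.
  rewrite !(mulrACA _ _ x1) !(mulrACA _ _ x0).
  by apply: sqrtr_cauchy_schwarz; rewrite mulr_ge0.
have -> : 1 - (q0 * x1 + (1 - q0) * x0) = q0 * (1 - x1) + (1 - q0) * (1 - x0) by ring.
have -> : 1 - (q1 * y1 + (1 - q1) * y0) = q1 * (1 - y1) + (1 - q1) * (1 - y0) by ring.
rewrite !(mulrACA _ _ (1 - x1)) !(mulrACA _ _ (1 - x0)).
by apply: sqrtr_cauchy_schwarz; rewrite mulr_ge0// subr_ge0.
Qed.

(** Each of the two outcomes loses at most [dq^2 / (2 k)] against the mean of its probabilities, and
    these means add up to 1. *)
Lemma two_point_affinity_ge (q0 dq k : R) : 0 < q0 -> 0 <= dq <= q0 ->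
  q0 <= 4^-1 -> 0 < k <= 2 * q0 ->
  1 - dq ^+ 2 / k <= two_point_affinity q0 (q0 + dq).
Proof.
move=> q00 /andP[dq0 dqq] q04 /andP[k0 k1].
have H1 := @sqrtr_mul_ge q0 (q0 + dq) k.
have H2 := @sqrtr_mul_ge (1 - q0) (1 - (q0 + dq)) k.
have {}H1 := H1 ltac:(lra) ltac:(lra) ltac:(lra).
have {}H2 := H2 ltac:(lra) ltac:(lra) ltac:(lra).
apply: le_trans (lerD H1 H2).
have -> : q0 - (q0 + dq) = - dq by ring.
have -> : 1 - q0 - (1 - (q0 + dq)) = dq by ring.
rewrite sqrrN invfM [2^-1 / k]mulrC mulrA.
by move: (dq ^+ 2 / k) => z; lra.
Qed.

(** Turns a bound on the squared affinity into a logarithm of [eta] over the whole range up to 1/4.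
    For [eta <= 1/16] the square of the base is already at most [eta]; otherwise the base is at most
    3/4, and its tenth power is below 1/16. *)
Lemma tenth_power_le (eta : R) : 0 < eta <= 1 / 4 ->
  (4 * eta * (1 - eta)) ^+ 10 <= eta.
Proof.
move=> /andP[e0 e4]; set t := 4 * eta * (1 - eta).
have t0 : 0 <= t by rewrite /t !mulr_ge0//; lra.
have t2 : 0 <= t ^+ 2 by rewrite exprn_ge0.
have -> : t ^+ 10 = t ^+ 2 * (t ^+ 2 * t ^+ 2) * (t ^+ 2 * t ^+ 2) by ring.
have [e16|e16] := leP eta 16^-1.
  have te : t ^+ 2 <= eta.
    have : t <= 4 * eta by rewrite /t; nra.
    by move=> te; nra.
  have : t ^+ 2 * t ^+ 2 <= 1 by rewrite mulr_ile1//; lra.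
  move: (t ^+ 2 * t ^+ 2) (mulr_ge0 t2 t2) => s s0 s1.
  rewrite -mulrA; apply: le_trans te; rewrite ler_piMr//.
  by rewrite mulr_ile1.
have t34 : t <= 3 / 4 by rewrite /t; nra.
have t2' : t ^+ 2 <= 9 / 16 by nra.
have t4 : t ^+ 2 * t ^+ 2 <= 1 / 3 by nra.
move: (t ^+ 2 * t ^+ 2) (mulr_ge0 t2 t2) t4 => s s0 s1.
have : s * s <= 1 / 9 by nra.
rewrite -mulrA; move: (s * s) (mulr_ge0 s0 s0) => r r0 r1.
by nra.
Qed.

Lemma expR_le_1B (w : R) : 0 <= w <= 2^-1 -> expR (- (2 * w)) <= 1 - w.
Proof.
move=> /andP[w0 w1]; rewrite expRN -[leRHS]invrK lef_pV2 ?posrE ?expR_gt0//; last first.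
  by rewrite invr_gt0; lra.
apply: le_trans (expR_ge1Dx _).
have w1' : 0 < 1 - w by lra.
by rewrite -[leLHS]mul1r ler_pdivrMr//; nra.
Qed.

End affinity.

(** * Lower bound on the sample size *)

Section lower_bound.
Context (R : realType).

Lemma error_probabilityE (P : probability R R) M (k : R.-pker (M.-tuple R) ~> R)
    (v eps : R) :
  error_probability P k v%:E eps =
  (\int[iid_law P M]_w k w [set u : R | eps < `|u - v|]%R)%E.
Proof. by []. Qed.

Lemma measurable_far (v eps : R) : measurable [set u : R | eps < `|u - v|].
Proof.
rewrite -[X in measurable X]setTI.
apply: (measurable_fun_ltr (measurable_cst eps)) => //.
by apply: measurableT_comp => //; exact: measurable_funB.
Qed.

(* The probability that the estimate is far from the value of one instance is a
   test separating two instances whose values are more than 2 eps apart. *)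
Lemma test_of_estimator (P0 P1 : probability R R) (v0 v1 eps eta : R) M
    (k : R.-pker (M.-tuple R) ~> R) :
  2 * eps < v0 - v1 ->
  (error_probability P0 k v0%:E eps <= eta%:E)%E ->
  (error_probability P1 k v1%:E eps <= eta%:E)%E ->
  exists f : seq R -> R, [/\ measurable_fun setT (fun w : M.-tuple R => f w),
    forall w, 0 <= f w <= 1,
    \int[iid_law P0 M]_w f w <= eta &
    1 - eta <= \int[iid_law P1 M]_w f w].
Proof.
rewrite !error_probabilityE => gap e0 e1.
pose far v := [set u : R | eps < `|u - v|].
pose F v (w : M.-tuple R) := fine (k w (far v)).
have kT w : k w setT = 1%E by exact: prob_kernel.
have k1 v w : (k w (far v) <= 1)%E.
  rewrite -(kT w); apply: le_measure; rewrite ?inE//; exact: measurable_far.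
have kE v w : k w (far v) = (F v w)%:E.
  rewrite /F fineK// ge0_fin_numE//.
  by rewrite (le_lt_trans (k1 v w))// ltry.
have mF v : measurable_fun setT (F v).
  apply/measurable_EFinP; apply: (eq_measurable_fun (fun w => k w (far v))).
    by move=> w _; rewrite kE.
  exact: (measurable_kernel k _ (measurable_far _ _)).
have F01 v w : 0 <= F v w <= 1.
  by rewrite -!lee_fin -kE measure_ge0/= k1.
have bF v : bounded_measurable (F v).
  by split => //; exists 1 => w; have /andP[? ?] := F01 v w; rewrite ger0_norm.
have errE P v : (\int[iid_law P M]_w k w (far v))%E
    = (\int[iid_law P M]_w F v w)%:E.
  by rewrite -EFin_Rintegral//; apply: eq_integral => w _; rewrite kE.
move: e0 e1; rewrite !errE !lee_fin => e0 e1.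
(* The test must be defined on all sequences. Those of length other than [M] are sent to a default
   tuple; on [M]-tuples nothing changes. *)
exists (fun s => F v0 (insubd (nseq_tuple M 0) s)).
have eqF : (fun w : M.-tuple R => F v0 (insubd (nseq_tuple M 0) (w : seq R))) = F v0.
  by apply/funext => w; rewrite valKd.
split; rewrite ?eqF//.
(* No output is within [eps] of both values, so the two far events cover the line. *)
have cover w : 1 <= F v0 w + F v1 w.
  rewrite -lee_fin EFinD -!kE -(kT w).
  apply: le_trans (measureU2 _ (measurable_far _ _) (measurable_far _ _)).
  apply: le_measure; rewrite ?inE//.
    exact: measurableU (measurable_far _ _) (measurable_far _ _).
  move=> u _; have [uv0|uv0] := ltP eps `|u - v0|; [by left|right] => /=.
  rewrite ltNge; apply/negP => uv1.
  have := ler_normB (u - v1) (u - v0).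
  have -> : u - v1 - (u - v0) = v0 - v1 by ring.
  by have := ler_norm (v0 - v1); lra.
have : \int[iid_law P1 M]_w 1 <= \int[iid_law P1 M]_w (F v0 w + F v1 w).
  apply: le_Rintegral_bounded => //; first exact: bounded_measurable_cst.
  exact: bounded_measurableD.
rewrite Rintegral_probability_cst RintegralD_bounded//.
by lra.
Qed.

(** Chain [expR (- 2 w M) <= (1 - w)^M <= s] and raise to the power 20: the square uses the bound on
    [s^2], its tenth power is at most [eta]. Hence the constant 40. *)
Lemma sample_bound_of_test (w s eta : R) M : 0 < w -> w <= 2^-1 ->
  (1 - w) ^+ M <= s -> s ^+ 2 <= 4 * eta * (1 - eta) -> 0 < eta <= 1 / 4 ->
  ln (1 / eta) <= 40 * M%:R * w.
Proof.
move=> w0 w2 ws s2 eta14; have /andP[eta0 _] := eta14.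
have w1 : 0 <= 1 - w by lra.
rewrite div1r lnV ?posrE// lerNl -ler_expR lnK ?posrE//.
apply: le_trans (tenth_power_le eta14).
have -> : expR (- (40 * M%:R * w)) = (expR (- (2 * w)) ^+ M) ^+ (2 * 10).
  by rewrite -exprM -expRM_natl; congr expR; rewrite !natrM; ring.
have sge : expR (- (2 * w)) ^+ M <= s.
  apply: le_trans ws; rewrite lerXn2r ?nnegrE ?expR_ge0//.
  by apply: expR_le_1B; rewrite w2 ltW.
have : 0 <= expR (- (2 * w)) ^+ M by rewrite exprn_ge0// expR_ge0.
move: (expR _ ^+ M) sge => e es e0.
have e2 : 0 <= e ^+ 2 by rewrite exprn_ge0.
have e2' : e ^+ 2 <= 4 * eta * (1 - eta).
  by apply: le_trans s2; rewrite lerXn2r ?nnegrE// (le_trans e0).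
rewrite (exprM e 2 10); move: (e ^+ 2) e2 e2' => t t0 t1.
by rewrite lerXn2r ?nnegrE// (le_trans t0).
Qed.

Lemma sample_lower_bound (T M : nat) (eps eta : R) :
  (8 <= T)%N -> 0 < eps <= T%:R / 128 -> 0 < eta <= 1 / 4 ->
  (exists est : @estimator R M, accurate T eps eta 1 est) ->
  T%:R ^+ 3 * eps ^- 2 * ln (1 / eta) <= 40 * (32 ^+ 2 * M%:R).
Proof.
move=> T8 /andP[eps0 epsT] eta14 [est acc].
have /andP[eta0 eta4] := eta14.
have T8' : 8 <= T%:R :> R by rewrite ler_nat.
have T0 : 0 < T%:R :> R by lra.
(* At [q0] the unit is likely to survive the horizon. The shift [dq] yields a gap
   [dq T (T - 1) / 4 >= 7/2 eps], and [dq <= q0] amounts to [eps <= T / 128]. *)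
pose q0 : R := (8 * T%:R)^-1; pose dq := 16 * eps / T%:R ^+ 2.
have q0T : q0 * T%:R = 8^-1 by rewrite /q0; field; rewrite gt_eqF.
have dqT : dq * T%:R ^+ 2 = 16 * eps by rewrite /dq; field; rewrite gt_eqF.
have q00 : 0 < q0 by rewrite /q0 invr_gt0 mulr_gt0.
have q0le : q0 <= 64^-1 by rewrite /q0 lef_pV2 ?posrE//; lra.
have T20 : 0 < T%:R ^+ 2 :> R by rewrite exprn_gt0.
have dq0 : 0 <= dq <= q0.
  rewrite /dq divr_ge0 ?(ltW T20)//=; last by lra.
  rewrite ler_pdivrMr// expr2 mulrA q0T; lra.
have /andP[dq0' dqq] := dq0.
have h0 : 0 <= q0 <= 2^-1 by apply/andP; split; lra.
have h1 : 0 <= q0 + dq <= 2^-1 by apply/andP; split; lra.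
have gap : 2 * eps < two_point_cost q0 T - two_point_cost (q0 + dq) T.
  apply: lt_le_trans (two_point_cost_gap (leq_trans _ T8) erefl dq0 (leqnn T)) => //.
  have : dq * (T%:R * (7 / 8 * T%:R)) <= dq * (T%:R * (T%:R - 1)).
    by rewrite ler_wpM2l// ler_wpM2l ?(ltW T0)//; lra.
  rewrite expr2 in dqT; lra.
have one01 : 0 < (1 : R) <= 1 by rewrite ltr01 lexx.
have h0' : 0 <= q0 <= 1 by apply/andP; split; lra.
have h1' : 0 <= q0 + dq <= 1 by apply/andP; split; lra.
have := acc _ 1 1 (two_point_unit_interval h0') one01 one01.
have := acc _ 1 1 (two_point_unit_interval h1') one01 one01.
rewrite !two_point_optimal_value// => e1 e0.
have [f [mf f01 f0 f1]] := test_of_estimator gap e0 e1.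
have := affinity_test h0' h1' mf f01; rewrite {2}/two_point_affinity.
have Rint01 (P : probability R R) : 0 <= \int[iid_law P M]_w f w <= 1.
  have bf : bounded_measurable (fun w : M.-tuple R => f w).
    by split => //; exists 1 => w; have /andP[? ?] := f01 w; rewrite ger0_norm.
  apply/andP; split; first by apply: Rintegral_ge0 => w _; case/andP: (f01 w).
  rewrite -[leRHS](Rintegral_probability_cst (iid_law P M)).
  apply: le_Rintegral_bounded => //; first exact: bounded_measurable_cst.
  by move=> w; case/andP: (f01 w).
have := affinity_sqr_le (Rint01 (two_point q0)) (Rint01 (two_point (q0 + dq))).
move: (\int[_]_w _) (\int[_]_w _) f0 f1 => b a ae be.
move: (Num.sqrt _ + Num.sqrt _) => s s2 rs.
have s2' : s ^+ 2 <= 4 * eta * (1 - eta).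
  apply: le_trans s2 _.
  (* The test accepts with probability at most [eta] in one case and at least [1 - eta] in the
     other, and [1 - (1 - 2 eta)^2 = 4 eta (1 - eta)]. *)
  have : (1 - 2 * eta) ^+ 2 <= (b - a) ^+ 2 by rewrite lerXn2r ?nnegrE//; lra.
  by lra.
(* The affinity loss [dq^2 / k] for [k = 2 q0]. *)
pose w := 4 * T%:R * dq ^+ 2.
have wE : w * T%:R ^+ 3 = 32 ^+ 2 * eps ^+ 2.
  have -> : w * T%:R ^+ 3 = 4 * (dq * T%:R ^+ 2) ^+ 2 by rewrite /w; ring.
  by rewrite dqT; ring.
have w0 : 0 < w.
  have T4 : 0 < 4 * T%:R :> R by rewrite mulr_gt0.
  by rewrite /w (pmulr_rgt0 _ T4) exprn_gt0// /dq divr_gt0// mulr_gt0.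
have w2 : w <= 2^-1.
  have : dq ^+ 2 <= q0 ^+ 2 by rewrite ler_sqr ?nnegrE// ltW.
  have : T%:R * q0 ^+ 2 <= 8^-1 * 64^-1 by rewrite expr2 mulrA [T%:R * _]mulrC q0T ler_pM2l.
  move=> A B; have : T%:R * dq ^+ 2 <= T%:R * q0 ^+ 2 by rewrite ler_pM2l.
  by rewrite /w; lra.
have aff : 1 - w <= two_point_affinity q0 (q0 + dq).
  have k0 : 0 < (4 * T%:R)^-1 :> R by rewrite invr_gt0 mulr_gt0.
  have := @two_point_affinity_ge _ q0 dq (4 * T%:R)^-1 q00 dq0.
  rewrite invrK [dq ^+ 2 * _]mulrC -/w; apply; first by lra.
  rewrite k0 /q0 /=; have -> : (4 * T%:R)^-1 = 2 * (8 * T%:R)^-1 :> R.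
    by field; rewrite gt_eqF.
  by [].
have w1 : 0 <= 1 - w by lra.
have ws : (1 - w) ^+ M <= s.
  by apply: le_trans rs; rewrite lerXn2r ?nnegrE// (le_trans w1).
have lnM := sample_bound_of_test w0 w2 ws s2' eta14.
have -> : T%:R ^+ 3 * eps ^- 2 = 32 ^+ 2 / w.
  have w0' : w != 0 by rewrite gt_eqF.
  have e0' : eps ^+ 2 != 0 by rewrite gt_eqF// exprn_gt0.
  apply: (mulIf w0'); apply: (mulIf e0').
  by rewrite mulfVK// mulrAC mulfVK// mulrC wE.
move: (ln _) (M%:R) lnM (32 ^+ 2) (sqr_ge0 (32 : R)) => l m lnM c c0.
rewrite -mulrA [leRHS]mulrCA; apply: ler_wpM2l => //.
by rewrite mulrC ler_pdivrMr.
Qed.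

End lower_bound.

(** * Block estimation with projected subgradient descent *)

Section adaptive_blocks.
Context (R : realType) (h p : R).

(** At the kink [d = S] the left slope is taken. *)
Definition cost_subgradient (S d : R) : R := if d < S then h else - p.

(** Demands form an infinite stream, so that blocks are index shifts. A finite sample enters through
    [nth 0], and [eq_block_cost] confines the dependence to the first [n] entries. *)
Fixpoint block_cost (S : R) (n : nat) (x : R) (w : nat -> R) : R :=
  match n with
  | 0 => 0
  | n.+1 => period_cost h p (Num.max x S) (clip (w 0%N))
            + block_cost S n (x - clip (w 0%N)) (fun i => w i.+1)
  end.

Lemma eq_block_cost S n x (w w' : nat -> R) :
  (forall i, (i < n)%N -> w i = w' i) -> block_cost S n x w = block_cost S n x w'.
Proof.
elim: n x w w' => //= n IH x w w' ww'; rewrite ww'//; congr (_ + _).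
by apply: IH => i ni; exact: (ww' i.+1 ni).
Qed.

Context (T : nat) (alpha : R).

(** One step per block, driven by its first demand alone. The level used in a block is therefore
    determined by earlier blocks. *)
Fixpoint sgd_level (b : nat) (w : nat -> R) : R :=
  match b with
  | 0 => 0
  | b.+1 => clip (sgd_level b w -
              alpha * cost_subgradient (sgd_level b w) (clip (w (b * T)%N)))
  end.

Lemma sgd_level01 b w : 0 <= sgd_level b w <= 1.
Proof. by case: b => [|b] /=; rewrite ?lexx ?ler01// clip_ge0 clip_le1. Qed.

Lemma eq_sgd_level b (w w' : nat -> R) : (0 < T)%N ->
  (forall i, (i < b * T)%N -> w i = w' i) -> sgd_level b w = sgd_level b w'.
Proof.
move=> T0; elim: b => //= b IH ww'.
rewrite IH => [|i ib]; last by apply: ww'; rewrite (leq_trans ib)// leq_mul.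
by rewrite ww'// mulSn -[ltnLHS]add0n ltn_add2r.
Qed.

Definition block (b : nat) (w : nat -> R) : nat -> R := fun i => w (b * T + i)%N.

Definition block_sum (Y : R -> (nat -> R) -> R) (K : nat) (w : nat -> R) : R :=
  \sum_(b < K) Y (sgd_level b w) (block b w).

Definition value_estimate (K : nat) (w : nat -> R) : R :=
  block_sum (fun S => block_cost S T 1) K w / K%:R.

Section measurability.
Context d (U : measurableType d).
Implicit Types (S X : U -> R) (D : nat -> U -> R).

Lemma measurable_cost_subgradient S X :
  measurable_fun setT S -> measurable_fun setT X ->
  measurable_fun setT (fun u => cost_subgradient (S u) (X u)).
Proof.
by move=> mS mX; apply: measurable_fun_ifT => //; exact: measurable_fun_ltr.
Qed.

Lemma measurable_clip_comp X :
  measurable_fun setT X -> measurable_fun setT (fun u => clip (X u)).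
Proof. by move=> mX; exact: (measurableT_comp (@measurable_clip R) mX). Qed.

Lemma measurable_block_cost n S X D :
  measurable_fun setT S -> measurable_fun setT X ->
  (forall i, measurable_fun setT (D i)) ->
  measurable_fun setT (fun u => block_cost (S u) n (X u) (fun i => D i u)).
Proof.
move=> mS; elim: n X D => [|n IH] X D mX mD /=; first exact: measurable_cst.
have mc := measurable_clip_comp (mD 0%N).
have mm : measurable_fun setT (fun u => Num.max (X u) (S u)) by exact: measurable_maxr.
apply: measurable_funD; last first.
  apply: (IH (fun u => X u - clip (D 0%N u)) (fun i => D i.+1)) => //.
  exact: measurable_funB.
by apply: measurable_funD; apply: measurable_funM => //;
  apply: measurable_maxr => //; exact: measurable_funB.
Qed.

Lemma measurable_sgd_level b D : (forall i, measurable_fun setT (D i)) ->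
  measurable_fun setT (fun u => sgd_level b (fun i => D i u)).
Proof.
move=> mD; elim: b => [|b IH] /=; first exact: measurable_cst.
apply: measurable_clip_comp; apply: measurable_funB => //.
apply: measurable_funM => //.
by apply: measurable_cost_subgradient => //; exact: measurable_clip_comp.
Qed.

Lemma measurable_block_sum (Y : R -> (nat -> R) -> R) K D :
  (forall S D', measurable_fun setT S -> (forall i, measurable_fun setT (D' i)) ->
     measurable_fun setT (fun u => Y (S u) (fun i => D' i u))) ->
  (forall i, measurable_fun setT (D i)) ->
  measurable_fun setT (fun u => block_sum Y K (fun i => D i u)).
Proof.
move=> mY mD; apply: measurable_sum => b.
apply: (mY _ (fun i => D (b * T + i)%N)) => //.
exact: measurable_sgd_level.
Qed.

End measurability.

Lemma measurable_nth n i : measurable_fun setT (fun w : n.-tuple R => nth 0 w i).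
Proof.
have [ni|ni] := ltnP i n; last first.
  apply: (eq_measurable_fun (fun _ : n.-tuple R => 0 : R)) => // w _.
  by rewrite nth_default// size_tuple.
apply: (eq_measurable_fun (fun w => tnth w (Ordinal ni))).
  by move=> w _; rewrite (tnth_nth 0).
exact: measurable_tnth.
Qed.

Lemma measurable_value_estimate K M :
  measurable_fun setT (fun w : M.-tuple R => value_estimate K (nth 0 w)).
Proof.
apply: measurable_funM => //.
apply: (measurable_block_sum _ (D := fun i (w : M.-tuple R) => nth 0 w i)).
  by move=> S D mS mD; apply: measurable_block_cost.
by move=> i; exact: measurable_nth.
Qed.

Context (P : probability R R).

(* Given the past, each block is a fresh sample of T demands evaluated at a level
   that depends only on the past, so conditional bounds multiply. *)
Lemma block_sum_mgf (Y : R -> (nat -> R) -> R) (l rho : R) (K : nat) :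
  (0 < T)%N ->
  (forall d (U : measurableType d) (S : U -> R) (D : nat -> U -> R),
     measurable_fun setT S -> (forall i, measurable_fun setT (D i)) ->
     measurable_fun setT (fun u => Y (S u) (fun i => D i u))) ->
  (forall S w w', (forall i, (i < T)%N -> w i = w' i) -> Y S w = Y S w') ->
  0 <= rho ->
  (forall S, 0 <= S <= 1 ->
     (\int[iid_law P T]_w (expR (l * Y S (nth 0 w)))%:E <= rho%:E)%E) ->
  (\int[iid_law P (K * T)]_w (expR (l * block_sum Y K (nth 0 w)))%:E
    <= (rho ^+ K)%:E)%E.
Proof.
move=> T0 mY locY rho0 Yrho.
have mS K' n : measurable_fun setT
    (fun w : n.-tuple R => (expR (l * block_sum Y K' (nth 0 w)))%:E).
  apply/measurable_EFinP; apply: measurableT_comp => //; apply: measurable_funM => //.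
  apply: (measurable_block_sum _ (D := fun i (w : n.-tuple R) => nth 0 w i)).
    by move=> S D; exact: mY.
  by move=> i; exact: measurable_nth.
elim: K => [|K IH].
  rewrite mul0n /= integral_dirac//; last exact: mS.
  by rewrite diracT mul1e /block_sum big_ord0 mulr0 expR0 expr0.
rewrite mulSn addnC.
rewrite (@iid_law_cat _ _ _ _ _ _ (fun w : seq R => (expR (l * block_sum Y K.+1 (nth 0 w)))%:E))//.
(* The past [u] fixes the first [K] summands and the level of the new block [v], so the exponential
   factors. *)
have split_block (u : (K * T).-tuple R) (v : seq R) :
    expR (l * block_sum Y K.+1 (nth 0 (u ++ v))) =
    expR (l * block_sum Y K (nth 0 u)) *
    expR (l * Y (sgd_level K (nth 0 u)) (nth 0 v)).
  rewrite -expRD -mulrDr; congr (expR (l * _)).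
  rewrite /block_sum big_ord_recr /=.
  have nthu i : (i < K * T)%N -> nth 0 (u ++ v) i = nth 0 u i.
    by move=> iK; rewrite nth_cat size_tuple iK.
  congr (_ + _).
    apply: eq_bigr => b _; rewrite (@eq_sgd_level _ _ (nth 0 u))//; last first.
      move=> i ib; apply: nthu; rewrite (leq_trans ib)// leq_mul//.
      exact: ltnW.
    apply: locY => i iT; apply: nthu.
    apply: (@leq_trans (b.+1 * T)); last by rewrite leq_mul.
    by rewrite mulSn addnC ltn_add2r.
  rewrite (@eq_sgd_level _ _ (nth 0 u))//; congr (Y _ _); apply/funext => i.
  by rewrite /block nth_cat size_tuple ltnNge leq_addr/= addKn.
apply: (@le_trans _ _ (\int[iid_law P (K * T)]_u
    ((expR (l * block_sum Y K (nth 0 u)))%:E * rho%:E))%E).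
  apply: ge0_le_integralT => u.
    by apply: integral_ge0 => v _; rewrite lee_fin expR_ge0.
  under eq_integral do rewrite split_block EFinM.
  rewrite ge0_integralZl_EFin ?expR_ge0//.
  - by rewrite lee_wpmul2l ?lee_fin ?expR_ge0// Yrho// sgd_level01.
  - apply/measurable_EFinP; apply: measurableT_comp => //; apply: measurable_funM => //.
    apply: (mY _ _ (fun=> _) (fun i (v : T.-tuple R) => nth 0 v i)) => // i.
    exact: measurable_nth.
rewrite ge0_integralZr//; last exact: mS.
rewrite exprSr EFinM lee_wpmul2r//.
Qed.

(** The branch of the cost active at [S] is affine in the level and lies below the cost
    everywhere. *)
Lemma cost_subgradientP (S s d : R) : 0 <= h -> 0 <= p ->
  period_cost h p S d - period_cost h p s d <= cost_subgradient S d * (S - s).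
Proof.
move=> h0 p0; rewrite /cost_subgradient; case: ltP => [/ltW dS|Sd].
  rewrite (period_cost_le _ _ dS).
  have : h * (s - d) <= period_cost h p s d.
    rewrite ler_wpDr ?mulr_ge0// ?le_max ?lexx ?orbT// ler_wpM2l//.
    by rewrite le_max lexx.
  by lra.
rewrite (period_cost_ge _ _ Sd).
have : p * (d - s) <= period_cost h p s d.
  rewrite ler_wpDl ?mulr_ge0// ?le_max ?lexx ?orbT// ler_wpM2l//.
  by rewrite le_max lexx.
by lra.
Qed.

Hypotheses (h01 : 0 < h <= 1) (p01 : 0 < p <= 1).

Lemma cost_subgradient_norm S d : `|cost_subgradient S d| <= 1.
Proof.
move: h01 p01 => /andP[h0 h1] /andP[p0 p1].
by rewrite /cost_subgradient; case: ifP => _; rewrite ?normrN gtr0_norm.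
Qed.

(* The potential of projected subgradient descent is (S_b - s)^2. *)
Lemma sgd_regret (s : R) (K : nat) (w : nat -> R) : 0 <= s <= 1 -> 0 < alpha ->
  \sum_(b < K) cost_subgradient (sgd_level b w) (clip (w (b * T)%N))
                 * (sgd_level b w - s)
  <= (2 * alpha)^-1 + alpha * K%:R / 2.
Proof.
move=> s01 a0; have a20 : 0 < 2 * alpha by rewrite mulr_gt0.
(* By [clip_contraction], expanding the squared distance after a step bounds [2 alpha g (S - s)] by
   the drop in potential plus [alpha^2]; the drops telescope. *)
suff H : 2 * alpha * \sum_(b < K)
    cost_subgradient (sgd_level b w) (clip (w (b * T)%N)) * (sgd_level b w - s)
    <= s ^+ 2 - (sgd_level K w - s) ^+ 2 + alpha ^+ 2 * K%:R.
  rewrite -(ler_pM2l a20); apply: le_trans H _.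
  rewrite mulrDr mulfV ?gt_eqF//.
  have : s ^+ 2 <= 1 by case/andP: s01 => s0 s1; rewrite exprn_ile1.
  have := sqr_ge0 (sgd_level K w - s); lra.
elim: K => [|K IH]; first by rewrite big_ord0 /=; lra.
rewrite big_ord_recr /= -natr1 mulrDr.
set S := sgd_level K w; set g := cost_subgradient S _.
have := clip_contraction (S - alpha * g) s01.
have g1 : g ^+ 2 <= 1.
  rewrite -real_normK ?num_real// exprn_ile1//; exact: cost_subgradient_norm.
have : alpha ^+ 2 * g ^+ 2 <= alpha ^+ 2 * 1 by rewrite ler_wpM2l// sqr_ge0.
by move: IH; rewrite -/S; lra.
Qed.

Lemma block_cost_bounds (S : R) n x w : 0 <= S <= 1 -> x <= 1 ->
  0 <= block_cost S n x w <= n%:R.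
Proof.
move=> /andP[S0 S1]; elim: n x w => [|n IH] x w x1 /=; first by rewrite lexx.
have c0 := clip_ge0 (w 0%N); have c1 := clip_le1 (w 0%N).
have /andP[IH0 IH1] := IH (x - clip (w 0%N)) (fun i => w i.+1) ltac:(lra).
have := period_cost_dist h01 p01 (Num.max x S) (clip (w 0%N)).
have := period_cost_ge0 h01 p01 (Num.max x S) (clip (w 0%N)).
have : `|Num.max x S - clip (w 0%N)| <= 1.
  have : S <= Num.max x S by rewrite le_max lexx orbT.
  have : Num.max x S <= 1 by rewrite ge_max x1.
  by rewrite ler_norml; lra.
by rewrite -natr1; lra.
Qed.

Lemma bounded_block_cost (S : R) n x : 0 <= S <= 1 -> x <= 1 ->
  bounded_measurable (fun w : n.-tuple R => block_cost S n x (nth 0 w)).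
Proof.
move=> S01 x1; split.
  apply: (@measurable_block_cost _ _ n (fun=> S) (fun=> x)
    (fun i (w : n.-tuple R) => nth 0 w i)) => // i.
  exact: measurable_nth.
exists n%:R => w; have /andP[b0 b1] := block_cost_bounds n (nth 0 w) S01 x1.
by rewrite ger0_norm.
Qed.

Lemma expected_block_cost (S : R) n x : 0 <= S <= 1 -> x <= 1 ->
  \int[iid_law P n]_w block_cost S n x (nth 0 w) = base_stock_cost h p P S n x.
Proof.
move=> S01; elim: n x => [|n IH] x x1.
  exact: Rintegral_probability_cst.
have fB w : `|block_cost S n.+1 x (nth 0 w)| <= n.+1%:R.
  by have /andP[b0 b1] := block_cost_bounds n.+1 (nth 0 w) S01 x1; rewrite ger0_norm.
rewrite (Rintegral_iid_cons P (bounded_block_cost n.+1 S01 x1).1 fB) /=.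
rewrite -RintegralD_bounded.
- apply: eq_Rintegral => d _.
  have xd1 : x - clip d <= 1 by have := clip_ge0 d; lra.
  rewrite RintegralD_bounded ?Rintegral_probability_cst ?IH//.
    exact: bounded_measurable_cst.
  exact: bounded_block_cost.
- exact: bounded_period_cost.
- exact: bounded_base_stock_cost.
Qed.

End adaptive_blocks.

(** * Concentration of the block estimator and upper bound *)

Section upper_bound.
Context (R : realType) (h p : R).
Hypotheses (h01 : 0 < h <= 1) (p01 : 0 < p <= 1).
Context (P : probability R R) (T : nat).
Hypothesis T0 : (0 < T)%N.
Context (s : R).
Hypothesis s_opt : newsvendor_optimal h p P s.

Let V := base_stock_cost h p P s T 1.

Let s01 : 0 <= s <= 1. Proof. by case: s_opt. Qed.
Let TR0 : 0 < T%:R :> R. Proof. by rewrite ltr0n. Qed.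

Let V_bounds : 0 <= V <= T%:R.
Proof.
rewrite /V base_stock_cost_ge0//= -(expected_block_cost P h01 p01 _ s01)//.
rewrite -[leRHS](Rintegral_probability_cst (iid_law P T)).
apply: le_Rintegral_bounded => [||w].
- exact: bounded_block_cost.
- exact: bounded_measurable_cst.
- by case/andP: (block_cost_bounds h01 p01 T (nth 0 w) s01 (lexx 1)).
Qed.

Let slope (S d : R) := cost_subgradient h p S (clip d) * (S - s).

Let slope_norm S d : 0 <= S <= 1 -> `|slope S d| <= 1.
Proof.
move=> S01; rewrite normrM mulr_ile1// ?(cost_subgradient_norm h01 p01)//.
by move: S01 s01 => /andP[? ?] /andP[? ?]; rewrite ler_norml; lra.
Qed.

Let measurable_slope d (U : measurableType d) (S X : U -> R) :
  measurable_fun setT S -> measurable_fun setT X ->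
  measurable_fun setT (fun u => slope (S u) (X u)).
Proof.
move=> mS mX; apply: measurable_funM; last exact: measurable_funB.
by apply: measurable_cost_subgradient => //; exact: measurable_clip_comp.
Qed.

Let bounded_slope S : 0 <= S <= 1 -> bounded_measurable (slope S).
Proof.
move=> S01; split; last by exists 1 => d; exact: slope_norm.
exact: (@measurable_slope _ _ (fun=> S) id).
Qed.

Let bounded_slope_head S n : 0 <= S <= 1 ->
  bounded_measurable (fun w : n.-tuple R => slope S (nth 0 w 0)).
Proof.
move=> S01; split; last by exists 1 => w; exact: slope_norm.
by apply: (@measurable_slope _ _ (fun=> S)) => //; exact: measurable_nth.
Qed.

Let expected_slope_head S : 0 <= S <= 1 ->
  \int[iid_law P T]_w slope S (nth 0 w 0) = \int[P]_d slope S d.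
Proof.
move=> S01; case: T T0 => // n _.
have fB (w : seq R) : `|slope S (nth 0 w 0)| <= 1 by exact: slope_norm.
rewrite (Rintegral_iid_cons P (bounded_slope_head n.+1 S01).1 fB).
by apply: eq_Rintegral => d _ /=; rewrite Rintegral_probability_cst.
Qed.

Let expected_cost_slope S : 0 <= S <= 1 ->
  expected_cost h p P S - expected_cost h p P s <= \int[P]_d slope S d.
Proof.
move=> S01; rewrite lerBlDl /expected_cost.
have bG := bounded_period_cost h01 p01.
rewrite -RintegralD_bounded//; last exact: bounded_slope.
apply: le_Rintegral_bounded => //.
  by apply: bounded_measurableD; [exact: bG|exact: bounded_slope].
move=> d; rewrite -lerBlDl; apply: cost_subgradientP.
  by case/andP: h01 => /ltW.
by case/andP: p01 => /ltW.
Qed.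

(* Discounting each block by T times the linearized regret of its level turns
   the overestimation error into a supermartingale difference. *)
Let overshoot (S : R) (w : nat -> R) := block_cost h p S T 1 w - V - T%:R * slope S (w 0%N).

(** Its mean is nonpositive at every level, by [base_stock_cost_min]. *)
Let undershoot (S : R) (w : nat -> R) := V - block_cost h p S T 1 w.

Context (l alpha : R).
Hypotheses (l0 : 0 <= l) (lT : l * (2 * T%:R) <= 2^-1).

(** Here [2 T] bounds the overshoot: the cost error is at most [T] in absolute value, and so is the
    discount. *)
Let rho := expR (2 * (l ^+ 2 * (2 * T%:R) ^+ 2)).

Let eqblock S (w w' : nat -> R) : (forall i, (i < T)%N -> w i = w' i) ->
  block_cost h p S T 1 w = block_cost h p S T 1 w'.
Proof. exact: eq_block_cost. Qed.

(** The mean cost of a block exceeds [V] by at most [T] times the expected-cost gap, and the mean of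
    [slope] is at least that gap, so each overshoot has nonpositive mean. *)
Let overshoot_mgf K :
  (\int[iid_law P (K * T)]_w
     (expR (l * block_sum h p T alpha overshoot K (nth 0 w)))%:E <= (rho ^+ K)%:E)%E.
Proof.
apply: block_sum_mgf => //.
- move=> d U S D mS mD; apply: measurable_funB.
    by apply: measurable_funB => //; exact: measurable_block_cost.
  by apply: measurable_funM => //; exact: measurable_slope.
- by move=> S w w' ww'; rewrite /overshoot (eqblock _ ww') ww'.
- exact: expR_ge0.
move=> S S01.
have bX := bounded_block_cost h01 p01 T S01 (lexx 1).
have bc : bounded_measurable (fun _ : T.-tuple R => - V) by exact: bounded_measurable_cst.
have bS := bounded_measurableZ (- T%:R) (bounded_slope_head T S01).
have overshootE w : overshoot S w = block_cost h p S T 1 w + - V + - T%:R * slope S (w 0%N).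
  by rewrite /overshoot mulNr.
have bO : bounded_measurable (fun w : T.-tuple R => overshoot S (nth 0 w)).
  rewrite (_ : (fun w : T.-tuple R => _) = fun w : T.-tuple R =>
    block_cost h p S T 1 (nth 0 w) + - V + - T%:R * slope S (nth 0 w 0)).
    by apply: bounded_measurableD => //; exact: bounded_measurableD.
  by apply/funext => w; exact: overshootE.
apply: mgf_bound => //; first exact: bO.1.
  move=> w; have /andP[V0 VT] := V_bounds.
  have /andP[X0 XT] := block_cost_bounds h01 p01 T (nth 0 w) S01 (lexx 1).
  have := slope_norm (nth 0 w 0) S01; rewrite ler_norml => /andP[r0 r1].
  have : T%:R * slope S (nth 0 w 0) <= T%:R * 1 by rewrite ler_pM2l.
  have : T%:R * -1 <= T%:R * slope S (nth 0 w 0) by rewrite ler_pM2l.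
  by rewrite /overshoot ler_norml; lra.
under eq_Rintegral do rewrite overshootE.
rewrite RintegralD_bounded//; last exact: bounded_measurableD.
rewrite RintegralD_bounded// Rintegral_probability_cst RintegralZ_bounded; last first.
  exact: bounded_slope_head.
rewrite expected_slope_head// expected_block_cost//.
have := base_stock_cost_regret h01 p01 T 1 s_opt (andP S01).1.
have : T%:R * (expected_cost h p P S - expected_cost h p P s) <=
    T%:R * \int[P]_d slope S d by rewrite ler_pM2l// expected_cost_slope.
by rewrite -/V; lra.
Qed.

Let undershoot_mgf K :
  (\int[iid_law P (K * T)]_w
     (expR (l * block_sum h p T alpha undershoot K (nth 0 w)))%:E <= (rho ^+ K)%:E)%E.
Proof.
apply: block_sum_mgf => //.
- move=> d U S D mS mD; apply: measurable_funB => //.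
  by exact: measurable_block_cost.
- by move=> S w w' ww'; rewrite /undershoot (eqblock _ ww').
- exact: expR_ge0.
move=> S S01.
have bX := bounded_block_cost h01 p01 T S01 (lexx 1).
have bc : bounded_measurable (fun _ : T.-tuple R => V) by exact: bounded_measurable_cst.
have bN := bounded_measurableZ (- 1) bX.
have undershootE w : undershoot S w = V + - 1 * block_cost h p S T 1 w.
  by rewrite /undershoot mulN1r.
have bU : bounded_measurable (fun w : T.-tuple R => undershoot S (nth 0 w)).
  rewrite (_ : (fun w : T.-tuple R => _) = fun w : T.-tuple R =>
    V + - 1 * block_cost h p S T 1 (nth 0 w)); first exact: bounded_measurableD.
  by apply/funext => w; exact: undershootE.
apply: mgf_bound => //; first exact: bU.1.
  move=> w; have /andP[V0 VT] := V_bounds.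
  have /andP[X0 XT] := block_cost_bounds h01 p01 T (nth 0 w) S01 (lexx 1).
  by rewrite /undershoot ler_norml; lra.
under eq_Rintegral do rewrite undershootE.
rewrite RintegralD_bounded// Rintegral_probability_cst RintegralZ_bounded//.
rewrite expected_block_cost// mulN1r subr_le0.
exact: (base_stock_cost_min h01 p01 T 1 s_opt (andP S01).1).
Qed.

Hypothesis alpha0 : 0 < alpha.

(** The discounts add up to [T] times the linearized regret, which [sgd_regret] bounds on every
    sample path. *)
Let estimate_overshoot K (w : nat -> R) :
  block_sum h p T alpha (fun S => block_cost h p S T 1) K w - K%:R * V <=
  block_sum h p T alpha overshoot K w
    + T%:R * ((2 * alpha)^-1 + alpha * K%:R / 2).
Proof.
have -> : block_sum h p T alpha overshoot K w =
    block_sum h p T alpha (fun S => block_cost h p S T 1) K w - K%:R * V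
    - T%:R * \sum_(b < K) slope (sgd_level h p T alpha b w) (w (b * T)%N).
  rewrite /block_sum /overshoot !sumrB sumr_const card_ord -mulr_sumr (mulr_natl V K).
  congr (_ - _ * _); apply: eq_bigr => b _; by rewrite /block addn0.
rewrite -lerBlDl opprB addrC subrK ler_pM2l//.
exact: sgd_regret.
Qed.

Let estimate_under K (w : nat -> R) :
  K%:R * V - block_sum h p T alpha (fun S => block_cost h p S T 1) K w =
  block_sum h p T alpha undershoot K w.
Proof.
by rewrite /block_sum /undershoot sumrB sumr_const card_ord mulr_natl.
Qed.

(** Chernoff bound for both signs of the error. An upward error gives at most [K eps / 2] to regret,
    so in a failure one of the two block sums is at least [K eps / 2] and its exponential, scaled by
    [c], is at least 1. *)
Lemma value_estimate_tail (K : nat) (eps : R) : (0 < K)%N ->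
  T%:R * ((2 * alpha)^-1 + alpha * K%:R / 2) <= K%:R * eps / 2 -> 0 <= eps ->
  (\int[iid_law P (K * T)]_w
     (\d_(value_estimate h p T alpha K (nth 0 w))%R [set u : R | (eps < `|u - V|)%R])
   <= (2 * (expR (- (l * (K%:R * eps / 2))) * rho ^+ K))%:E)%E.
Proof.
move=> K0 regret eps0; have KR : 0 < K%:R :> R by rewrite ltr0n.
pose c := expR (- (l * (K%:R * eps / 2))).
have c0 : 0 <= c by exact: expR_ge0.
pose E Y (w : (K * T).-tuple R) := expR (l * block_sum h p T alpha Y K (nth 0 w)).
have mblock Y :
    (forall d (U : measurableType d) (S : U -> R) (D : nat -> U -> R),
     measurable_fun setT S -> (forall i, measurable_fun setT (D i)) ->
     measurable_fun setT (fun u => Y (S u) (fun i => D i u))) ->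
    measurable_fun setT (fun w => (E Y w)%:E).
  move=> mY; apply/measurable_EFinP; apply: measurableT_comp => //.
  apply: measurable_funM => //.
  apply: (@measurable_block_sum _ h p T alpha _ _ Y K
    (fun i (w : (K * T).-tuple R) => nth 0 w i)).
    by move=> S D; exact: mY.
  by move=> i; exact: measurable_nth.
have mover : measurable_fun setT (fun w => (E overshoot w)%:E).
  apply: mblock => d U S D mS mD; apply: measurable_funB.
    by apply: measurable_funB => //; exact: measurable_block_cost.
  by apply: measurable_funM => //; exact: measurable_slope.
have munder : measurable_fun setT (fun w => (E undershoot w)%:E).
  apply: mblock => d U S D mS mD; apply: measurable_funB => //.
  exact: measurable_block_cost.
have E0 Y w : (0 <= (E Y w)%:E)%E by rewrite lee_fin expR_ge0.
apply: (@le_trans _ _ (\int[iid_law P (K * T)]_w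
    (c%:E * ((E overshoot w)%:E + (E undershoot w)%:E)))%E).
  apply: ge0_le_integralT => w; first exact: measure_ge0.
  rewrite diracE; have [|_] := boolP (_ \in _); last first.
    by rewrite mule_ge0// adde_ge0.
  rewrite inE /= => far.
  set X := block_sum h p T alpha (fun S => block_cost h p S T 1) K (nth 0 w).
  have far' : K%:R * eps < `|X - K%:R * V|.
    have -> : X - K%:R * V = K%:R * (X / K%:R - V) by field; rewrite gt_eqF.
    by rewrite normrM gtr0_norm// ltr_pM2l.
  have expc y : K%:R * eps / 2 <= y -> 1 <= c * expR (l * y).
    move=> le_y; rewrite /c -expRD -[leLHS]expR0 ler_expR addrC subr_ge0.
    by rewrite ler_wpM2l.
  have Keps : 0 <= K%:R * eps by rewrite mulr_ge0// ltW.
  rewrite -EFinD -EFinM lee_fin mulrDr.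
  have [XV|XV] := leP 0 (X - K%:R * V).
    rewrite ger0_norm// in far'.
    apply: ler_wpDr; first by rewrite mulr_ge0// expR_ge0.
    by apply: expc; have := estimate_overshoot K (nth 0 w); rewrite -/X; lra.
  rewrite ltr0_norm// opprB in far'.
  apply: ler_wpDl; first by rewrite mulr_ge0// expR_ge0.
  by apply: expc; rewrite -estimate_under -/X; lra.
rewrite ge0_integralZl_EFin//; first last.
- exact: emeasurable_funD.
- by move=> w _; rewrite adde_ge0.
rewrite ge0_integralD//.
apply: le_trans (lee_wpmul2l _ (leeD (overshoot_mgf K) (undershoot_mgf K))) _; first by rewrite lee_fin.
by rewrite -EFinD -EFinM lee_fin -/c; lra.
Qed.

End upper_bound.

(** Keeps the logarithm away from zero, so that additive constants are absorbed. The quadratic bound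
    at 1/2 gives [expR (1/2) <= 2]. *)
Lemma ln_inv_ge_half (R : realType) (eta : R) :
  0 < eta -> eta <= 1 / 4 -> 2^-1 <= ln (1 / eta).
Proof.
move=> eta0 eta4; rewrite div1r lnV ?posrE// lerNr -ler_expR lnK ?posrE// expRN.
apply: le_trans (eta4) _; rewrite div1r lef_pV2 ?posrE ?expR_gt0//.
apply: le_trans (expR_le_quadratic _) _; last by lra.
by rewrite ger0_norm.
Qed.

Lemma sample_upper_bound (R : realType) (T K : nat) (eps eta : R) :
  (0 < T)%N -> 0 < eps <= T%:R -> 0 < eta <= 1 / 4 ->
  256 * (T%:R ^+ 2 / eps ^+ 2 * ln (1 / eta)) <= K%:R ->
  exists est : @estimator R (K * T), accurate T eps eta 1 est.
Proof.
move=> T0 /andP[eps0 epsT] /andP[eta0 eta4] HK.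
have TR : 0 < T%:R :> R by rewrite ltr0n.
have e20 : 0 < eps ^+ 2 by rewrite exprn_gt0.
have ln_eta := ln_inv_ge_half eta0 eta4.
pose Q := T%:R ^+ 2 / eps ^+ 2.
have Q1 : 1 <= Q.
  by rewrite ler_pdivlMr// mul1r lerXn2r ?nnegrE// ltW.
have KQ : 128 * Q <= K%:R.
  apply: le_trans HK; rewrite -/Q.
  have : Q * 2^-1 <= Q * ln (1 / eta) by rewrite ler_wpM2l//; lra.
  lra.
have K0 : (0 < K)%N by rewrite -(ltr0n R); lra.
have KR : 0 < K%:R :> R by rewrite ltr0n.
(* This step size makes the term growing with [K] exactly [K eps / 4]; the other one is [Q eps],
   covered by [K >= 128 Q]. *)
pose alpha := eps / (2 * T%:R).
have alpha0 : 0 < alpha by rewrite divr_gt0// mulr_gt0.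
(* Minimizes the exponent [- l K eps / 2 + 8 K l^2 T^2] of the tail bound, with minimum
   [- K / (128 Q)]. *)
pose l := eps / (32 * T%:R ^+ 2).
have T20 : 0 < T%:R ^+ 2 :> R by rewrite exprn_gt0.
have l0 : 0 <= l by rewrite divr_ge0 ?(ltW eps0)// mulr_ge0// ltW.
have lT : l * (2 * T%:R) <= 2^-1.
  have -> : l * (2 * T%:R) = eps / T%:R / 16 by rewrite /l; field; rewrite gt_eqF.
  have : eps / T%:R <= 1 by rewrite ler_pdivrMr// mul1r.
  lra.
have regret : T%:R * ((2 * alpha)^-1 + alpha * K%:R / 2) <= K%:R * eps / 2.
  have -> : T%:R * ((2 * alpha)^-1 + alpha * K%:R / 2) = Q * eps + K%:R * eps / 4.
    by rewrite /alpha /Q; field; rewrite !gt_eqF.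
  have : 128 * Q * eps <= K%:R * eps by rewrite ler_pM2r.
  have : 0 <= Q * eps by rewrite mulr_ge0 ?ltW//; lra.
  lra.
exists (fun h p => kdirac (@measurable_value_estimate R h p T alpha K (K * T)%N)).
move=> P h p P01 h01 p01.
have [s s_opt] := newsvendor_optimal_exists h01 p01 P.
rewrite (optimal_value_base_stock P01 h01 p01 1 T s_opt).
apply: le_trans (value_estimate_tail h01 p01 T0 s_opt l0 lT alpha0 K0 regret (ltW eps0)) _.
rewrite lee_fin -expRM_natl -expRD.
have -> : - (l * (K%:R * eps / 2)) + K%:R * (2 * (l ^+ 2 * (2 * T%:R) ^+ 2)) =
    - (K%:R / (128 * Q)).
  by rewrite /l /Q; field; rewrite !gt_eqF.
(* The factor 2 makes each tail at most [eta^2], and [2 eta^2 <= eta] for [eta <= 1/4]. *)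
have : 2 * ln (1 / eta) <= K%:R / (128 * Q).
  rewrite ler_pdivlMr; first by apply: le_trans HK; rewrite -/Q; lra.
  by rewrite mulr_gt0//; lra.
rewrite div1r lnV ?posrE// => HL.
have : expR (- (K%:R / (128 * Q))) <= eta ^+ 2.
  rewrite -[leRHS]lnK ?posrE ?exprn_gt0// ler_expR lnXn// mulr2n; lra.
have : eta ^+ 2 <= eta / 4 by rewrite expr2 ler_pM2l//; lra.
lra.
Qed.

(** * The two bounds combined *)

Lemma ler_div_nat (R : realType) (x : R) (m n : nat) :
  0 <= x -> (0 < m)%N -> (m <= n)%N -> x / n%:R <= x / m%:R.
Proof.
move=> x0 m0 mn; rewrite ler_wpM2l// lef_pV2 ?posrE ?ltr0n ?ler_nat//.
exact: leq_trans mn.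
Qed.

Theorem mainTheorem14 (R : realType) :
  exists c C : R, [/\ 0 < c, 0 < C &
    forall (T : nat) (eps eta : R),
      (8 <= T)%N -> 0 < eps <= T%:R / 1024 -> 0 < eta <= 1 / 4 ->
      exists M : nat, is_sample_complexity T eps eta 1 M /\
        c * (T%:R ^+ 3 * eps ^- 2 * ln (1 / eta)) <= M%:R
          <= C * (T%:R ^+ 3 * eps ^- 2 * ln (1 / eta))].
Proof.
pose c0 : R := 40 * 32 ^+ 2.
have c0_gt0 : 0 < c0 by rewrite mulr_gt0// exprn_gt0.
(* [c0] comes from the lower bound. Rounding gives [K <= 256 A + 1], and [A >= 1/2] turns the 1 into
   [2 A], whence 258. *)
exists c0^-1, 258; split; rewrite ?invr_gt0// => T eps eta T8 /andP[eps0 eps1024] eta14.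
have /andP[eta0 eta4] := eta14.
have TR : 0 < T%:R :> R by rewrite ltr0n (leq_trans _ T8).
have eps128 : 0 < eps <= T%:R / 128.
  rewrite eps0; apply: le_trans eps1024 _.
  by apply: ler_div_nat; first exact: ltW.
have epsT : 0 < eps <= T%:R.
  rewrite eps0; apply: le_trans eps1024 _; rewrite -[leRHS]divr1.
  by apply: (@ler_div_nat _ _ 1); first exact: ltW.
have e20 : 0 < eps ^+ 2 by rewrite exprn_gt0.
pose A := T%:R ^+ 2 / eps ^+ 2 * ln (1 / eta).
have A_ge : 2^-1 <= A.
  rewrite -[leLHS]mul1r /A; apply: ler_pM => //; last exact: ln_inv_ge_half.
  rewrite ler_pdivlMr// mul1r; case/andP: epsT => _ epsT.
  by rewrite lerXn2r ?nnegrE// ltW.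
have A0 : 0 <= 256 * A by lra.
have AT : T%:R ^+ 3 * eps ^- 2 * ln (1 / eta) = A * T%:R.
  by rewrite /A; move: (ln _) => y; field; rewrite gt_eqF.
pose K := (Num.truncn (256 * A)).+1.
have /andP[K1 K2] := truncn_itv A0.
have estK : exists est : @estimator R (K * T), accurate T eps eta 1 est.
  by apply: sample_upper_bound => //; [rewrite (leq_trans _ T8)|exact: ltW].
have exM : exists M, `[< exists est : @estimator R M, accurate T eps eta 1 est >].
  by exists (K * T)%N; apply/asboolP.
exists (ex_minn exM); case: ex_minnP => M /asboolP estM minM; split.
  by split=> // M' estM'; apply: minM; apply/asboolP.
have low := sample_lower_bound T8 eps128 eta14 estM.
apply/andP; split; first by rewrite (ler_pdivrMl _ _ c0_gt0) /c0 -[leRHS]mulrA.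
have /minM MK : `[< exists est : @estimator R (K * T), accurate T eps eta 1 est >].
  exact/asboolP.
apply: (@le_trans _ _ (K * T)%:R); first by rewrite ler_nat.
rewrite AT mulrA natrM (ler_pM2r TR).
have -> : K%:R = (Num.truncn (256 * A))%:R + 1 :> R by rewrite /K natr1.
by move: (Num.truncn _)%:R K1 => k K1; lra.
Qed.
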